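(* Let $L,n\ge 1$ be integers with $Ln>2$, let $\boldsymbol{\Sigma}$ be an $n\times n$ covariance matrix of full rank, let the data be multivariate white noise $\mathbf{x}_t=\boldsymbol{\epsilon}_t$ with covariance $\boldsymbol{\Sigma}$, and let $\boldsymbol{\gamma}_{\delta}\neq\mathbf{0}$. Fix $i\in\{1,\dots,n\}$, and consider the M-SSA problem for the $i$-th target with parameter $\rho_i$ (notation as in the context). Assume: (1) $\rho_i\neq\rho_{i,MSE}$ (non-degenerate case); (2) $|\rho_i|<\rho_{max}(L)$ (interior point); (3) the MSE estimate $\boldsymbol{\gamma}_{i\cdot\delta}$ has complete spectral support (completeness). Then: (a) The solution $\mathbf{b}_i$ of the M-SSA problem can be written in the general parametric form $$\mathbf{b}_{i}=D_i\mathbf{N}_i^{-1}\tilde{\mathbf{I}}\boldsymbol{\gamma}_{i\cdot\delta}=D_i\sum_{k=1}^L\frac{1}{2\lambda_{k}-\nu_i}\Big(\sum_{j=1}^n w_{ikj}\tilde{\mathbf{v}}_{kj}\Big),\qquad( * )$$ where $D_i\neq 0$, $\nu_i\in\mathbb{R}\setminus\{2\lambda_k : k=1,\dots,L\}$, and $\mathbf{N}_i:=2\tilde{\mathbf{M}}-\nu_i\tilde{\mathbf{I}}$ is an invertible symmetric $nL\times nL$ matrix. The scaling $D_i=D_i(\nu_i,l)$ depends on $\nu_i$ and on the length constraint, and its sign is determined by the requirement of a positive objective function, $\boldsymbol{\gamma}_{i\cdot\delta}'\tilde{\mathbf{I}}\mathbf{b}_{i}>0$. (b) The first-order autocorrelation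 $\rho(\nu_i)$ of $y_{it}$ based on $\mathbf{b}_i=\mathbf{b}_i(\nu_i)$ in $( * )$ is $$\rho(\nu_i):=\frac{\mathbf{b}_{i}(\nu_i)'\tilde{\mathbf{M}}\mathbf{b}_{i}(\nu_i)}{\mathbf{b}_{i}(\nu_i)'\tilde{\mathbf{I}}\mathbf{b}_{i}(\nu_i)}=\frac{\sum_{k=1}^{L}\lambda_k\frac{1}{(2\lambda_k-\nu_i)^2}\left(\sum_{j=1}^{n}\tilde{\sigma}_jw_{ikj}^2\right)}{\sum_{k=1}^{L}\frac{1}{(2\lambda_k-\nu_i)^2}\left(\sum_{j=1}^{n}\tilde{\sigma}_jw_{ikj}^2\right)}.$$ Any $\rho_i$ with $|\rho_i|<\rho_{max}(L)$ is permissible in the holding-time constraint, i.e. there exists $\nu_i$ such that $\rho(\nu_i)=\rho_i$. (c) The derivative $d\rho(\nu_i)/d\nu_i$ is strictly negative for $\nu_i\in\{\nu : |\nu|>2\rho_{max}(L)\}$. Furthermore $$\max_{\nu_i<-2\rho_{max}(L)}\rho(\nu_i)=\min_{\nu_i>2\rho_{max}(L)}\rho(\nu_i)=\rho_{i,MSE},$$ where $\rho_{i,MSE}=\lim_{|\nu_i|\to\infty}\rho(\nu_i)$ is the first-order autocorrelation of the $i$-th MSE predictor. Finally, for any $\nu_{1i}>2\rho_{max}(L)$ and $\nu_{2i}<-2\rho_{max}(L)$ one has $\rho(\nu_{1i})>\rho(\nu_{2i})$. (d) For $\nu_i\in\{\nu : |\nu|>2\rho_{max}(L)\}$, the derivatives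 of the objective function (target correlation) and of the first-order autocorrelation as functions of $\nu_i$ are related by $$-\mathrm{sign}(\nu_i)\,\frac{d\rho(y_i(\nu_i),z_i,\delta)}{d\nu_i}=\frac{\sqrt{\boldsymbol{\gamma}_{i\cdot\delta}'\tilde{\mathbf{I}}'\,\mathbf{N}_i^{-2}\,\tilde{\mathbf{I}}\boldsymbol{\gamma}_{i\cdot\delta}}}{\sqrt{\boldsymbol{\gamma}_{i\cdot\delta}'\tilde{\mathbf{I}}'\tilde{\mathbf{I}}\boldsymbol{\gamma}_{i\cdot\delta}}}\;\frac{d\rho(\nu_i)}{d\nu_i}<0,$$ where $\mathbf{N}_i^{-2}:=(\mathbf{N}_i^{-1})'\mathbf{N}_i^{-1}=(\mathbf{N}_i^{-1})^2$, $y_{it}(\nu_i)$ is the output of the filter with weights $\mathbf{b}_i$ given by $( * )$, and $\rho(y_i(\nu_i),z_i,\delta)$ is the target correlation (objective function).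
   Context: Matrices and spectral notation. $\mathbf{M}$ is the $L\times L$ symmetric tridiagonal matrix with zero diagonal and $1/2$ on the first super- and sub-diagonals. Its eigenvalues are $\lambda_k=\cos(k\pi/(L+1))$, $k=1,\dots,L$ (distinct, in decreasing order), with orthonormal eigenvectors $\mathbf{v}_k\propto(\sin(mk\pi/(L+1)))_{m=1,\dots,L}$. Put $\rho_{max}(L):=\lambda_1=\cos(\pi/(L+1))$. $\boldsymbol{\Sigma}$ (symmetric positive definite, $n\times n$) has eigenvalues $\tilde{\sigma}_j>0$ and orthonormal eigenvectors $\mathbf{v}_{\sigma j}$, $j=1,\dots,n$. Set $\tilde{\mathbf{I}}:=\boldsymbol{\Sigma}\otimes\mathbf{I}_{L\times L}$, $\tilde{\mathbf{M}}:=\boldsymbol{\Sigma}\otimes\mathbf{M}$ and $\tilde{\mathbf{v}}_{kj}:=\mathbf{v}_{\sigma j}\otimes\mathbf{v}_k$, an orthonormal basis of $\mathbb{R}^{nL}$. A prime denotes transposition. Target, predictor. $\boldsymbol{\epsilon}_t=(\epsilon_{1t},\dots,\epsilon_{nt})'$ is zero-mean white noise with covariance $\boldsymbol{\Sigma}$; the target is $\mathbf{z}_{t+\delta}=\sum_{|k|<\infty}\boldsymbol{\Gamma}_k\boldsymbol{\epsilon}_{t+\delta-k}$, $\delta\in\mathbb{Z}$, with square-summable $n\times n$ matrices $\boldsymbol{\Gamma}_k=(\gamma_{ijk})_{i,j}$. Put $\boldsymbol{\gamma}_{ij\delta}=(\gamma_{ij\delta},\gamma_{ij,\delta+1},\dots,\gamma_{ij,\delta+L-1})'\in\mathbb{R}^L$,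 $\boldsymbol{\gamma}_{i\cdot\delta}=(\boldsymbol{\gamma}_{i1\delta}',\dots,\boldsymbol{\gamma}_{in\delta}')'\in\mathbb{R}^{nL}$ (weights of the $i$-th mean-squared-error (MSE) predictor), and $\boldsymbol{\gamma}_\delta=(\boldsymbol{\gamma}_{1\cdot\delta},\dots,\boldsymbol{\gamma}_{n\cdot\delta})$. A predictor with weights $\mathbf{b}_i=(\mathbf{b}_{i1}',\dots,\mathbf{b}_{in}')'\in\mathbb{R}^{nL}$, $\mathbf{b}_{ij}\in\mathbb{R}^L$, is $y_{it}=\sum_{j=1}^n\mathbf{b}_{ij}'(\epsilon_{jt},\dots,\epsilon_{j,t-L+1})'$. Its first-order autocorrelation is $\rho(y_i)=\mathbf{b}_i'\tilde{\mathbf{M}}\mathbf{b}_i/\mathbf{b}_i'\tilde{\mathbf{I}}\mathbf{b}_i$. The target correlation is $\rho(y_i,z_i,\delta):=\mathbf{b}_i'\tilde{\mathbf{I}}\boldsymbol{\gamma}_{i\cdot\delta}/\sqrt{\mathbf{b}_i'\tilde{\mathbf{I}}\mathbf{b}_i\;\boldsymbol{\gamma}_{i\cdot\delta}'\tilde{\mathbf{I}}\boldsymbol{\gamma}_{i\cdot\delta}}$. The first-order autocorrelation of the $i$-th MSE predictor is $\rho_{i,MSE}:=\boldsymbol{\gamma}_{i\cdot\delta}'\tilde{\mathbf{M}}\boldsymbol{\gamma}_{i\cdot\delta}/\boldsymbol{\gamma}_{i\cdot\delta}'\tilde{\mathbf{I}}\boldsymbol{\gamma}_{i\cdot\delta}$.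 Spectral weights: $\boldsymbol{\gamma}_{i\cdot\delta}=\sum_{k=1}^L\sum_{j=1}^n w_{ikj}\tilde{\mathbf{v}}_{kj}$. $\boldsymbol{\gamma}_{i\cdot\delta}$ has complete spectral support if $\sum_{j=1}^n|w_{ikj}|\ne0$ for every $k=1,\dots,L$. M-SSA problem for the $i$-th target: maximize $\boldsymbol{\gamma}_{i\cdot\delta}'\tilde{\mathbf{I}}\mathbf{b}_i$ over $\mathbf{b}_i\in\mathbb{R}^{nL}$ subject to $\mathbf{b}_i'\tilde{\mathbf{M}}\mathbf{b}_i=l\rho_i$ (holding-time constraint) and $\mathbf{b}_i'\tilde{\mathbf{I}}\mathbf{b}_i=l$ (length constraint), where $l>0$ is a fixed scaling constant (typically $l=1$).
   Formalization: In (d) the printed factor, false for n=1, Σ≠1, is corrected to √(γ'Ĩ'N⁻¹'ĨN⁻¹Ĩγ)/√(γ'Ĩγ), the printed one being kept for Σ=I; in (c) the unattained max/min are sup/inf; in (b) ρ_i≠ρ_MSE is assumed, as in (1). *)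

(* Defs.v *)
From HB Require Import structures.
From mathcomp Require Import all_boot all_order all_algebra.
From mathcomp Require Export mxtens.
From mathcomp Require Import all_classical all_reals all_analysis.
Set Implicit Arguments.
Unset Strict Implicit.
Unset Printing Implicit Defensive.
Import Order.TTheory GRing.Theory Num.Theory.
Import numFieldNormedType.Exports.
Local Open Scope classical_set_scope.
Local Open Scope ring_scope.

(* x' A y *)
Definition bform (R : pzRingType) (m : nat) (A : 'M[R]_m) (x y : 'cV[R]_m) : R :=
  (x^T *m A *m y) 0 0.

Definition orthonormal_family (R : pzRingType) (m : nat) (I : finType)
    (v : I -> 'cV[R]_m) : Prop :=
  forall i j : I, bform 1%:M (v i) (v j) = (i == j)%:R.

Definition covariance_matrix (R : realType) (n : nat) (S : 'M[R]_n) : Prop :=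
  S^T = S /\ forall x : 'cV[R]_n, 0 <= bform S x x.

Section white_noise.
Context {d : measure_display} {T : measurableType d} {R : realType}.
Context (P : probability T R).
Local Open Scope ereal_scope.

Definition white_noise (n : nat) (Sigma : 'M[R]_n)
    (eps : int -> 'I_n -> {RV P >-> R}) : Prop :=
  [/\ forall t i, (eps t i : T -> R) \in Lfun P 2%:E,
      forall t i, 'E_P[eps t i] = 0
    & forall s t i j, covariance P (eps s i) (eps t j) =
        (if s == t then Sigma i j else 0%R)%:E].

(* Entry (j, m) of b, at position mxtens_index (j, m) = j * L + m, is the weight
   of eps_(j, t - m). *)
Definition filter_output (n L : nat) (eps : int -> 'I_n -> {RV P >-> R})
    (b : 'cV[R]_(n * L)) (t : int) : T -> R :=
  fun x => (\sum_(j < n) \sum_(m < L)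
    b (mxtens_index (j, m)) 0 * eps (t - m%:Z) j x)%R.

Definition autocorrelation1 (y : int -> T -> R) (t : int) : R :=
  (fine (covariance P (y t) (y (t - 1)%R)) /
   (Num.sqrt (fine 'V_P[y t]) * Num.sqrt (fine 'V_P[y (t - 1)%R])))%R.

End white_noise.

(* Square summability of the coefficient matrices, entrywise *)
Definition square_summable (R : realType) (n : nat) (Gamma : int -> 'M[R]_n) :
    Prop :=
  forall i j, summable [set: int] (fun k => ((Gamma k i j) ^+ 2)%:E).

(* The matrix gamma_delta: its i-th column is gamma_(i . delta), stacking over j
   the vectors (gamma_(i j delta), ..., gamma_(i j, delta + L - 1))'. *)
Definition mse_weights (R : realType) (n L : nat) (Gamma : int -> 'M[R]_n)
    (delta : int) : 'M[R]_(n * L, n) :=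
  \matrix_(r, i) Gamma (delta + (mxtens_unindex r).2%:Z) i (mxtens_unindex r).1.

Section spectral.
Context (R : realType).

Definition Mmx (L : nat) : 'M[R]_L :=
  \matrix_(i, j) (if (i.+1 == j)%N || (j.+1 == i)%N then 2^-1 else 0).

(* The index k : 'I_L stands for k + 1 in the usual 1-based numbering. *)
Definition lambda (L : nat) (k : 'I_L) : R := cos (k.+1%:R * pi / L.+1%:R).

Definition rho_max (L : nat) : R := cos (pi / L.+1%:R).

Definition sine_vec (L : nat) (k : 'I_L) : 'cV[R]_L :=
  \col_m sin ((m.+1 * k.+1)%:R * pi / L.+1%:R).

Definition Mvec (L : nat) (k : 'I_L) : 'cV[R]_L :=
  (Num.sqrt (bform 1%:M (sine_vec k) (sine_vec k)))^-1 *: sine_vec k.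

Definition Itilde (n L : nat) (Sigma : 'M[R]_n) : 'M[R]_(n * L) :=
  Sigma *t (1%:M : 'M[R]_L).

Definition Mtilde (n L : nat) (Sigma : 'M[R]_n) : 'M[R]_(n * L) :=
  Sigma *t Mmx L.

Definition vtilde (n L : nat) (vsigma : 'I_n -> 'cV[R]_n) (k : 'I_L) (j : 'I_n) :
    'cV[R]_(n * L) :=
  vsigma j *t Mvec k.

Definition complete_spectral_support (n L : nat) (w : 'I_L -> 'I_n -> R) : Prop :=
  forall k, \sum_(j < n) `|w k j| != 0.

End spectral.

Arguments Itilde {R n} L Sigma.
Arguments Mtilde {R n} L Sigma.
Arguments rho_max {R} L.
Arguments lambda {R L} k.

Section mssa.
Context (R : realType) (n L : nat) (Sigma : 'M[R]_n).
Let It := Itilde L Sigma.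
Let Mt := Mtilde L Sigma.

Definition acf (b : 'cV[R]_(n * L)) : R := bform Mt b b / bform It b b.

Definition target_corr (gamma b : 'cV[R]_(n * L)) : R :=
  bform It b gamma / Num.sqrt (bform It b b * bform It gamma gamma).

Definition mssa_feasible (rho l : R) (b : 'cV[R]_(n * L)) : Prop :=
  bform Mt b b = l * rho /\ bform It b b = l.

Definition mssa_solution (gamma : 'cV[R]_(n * L)) (rho l : R)
    (b : 'cV[R]_(n * L)) : Prop :=
  mssa_feasible rho l b /\
  forall b', mssa_feasible rho l b' -> bform It gamma b' <= bform It gamma b.

Definition Nmx (nu : R) : 'M[R]_(n * L) := 2 *: Mt - nu *: It.

Definition admissible (nu : R) : Prop := forall k : 'I_L, nu != 2 * lambda k.

(* N^-1 It gamma *)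
Definition mssa_direction (gamma : 'cV[R]_(n * L)) (nu : R) : 'cV[R]_(n * L) :=
  invmx (Nmx nu) *m It *m gamma.

(* The modulus is fixed by the length constraint b' It b = l, the sign by
   gamma' It b > 0. When gamma' It N^-1 It gamma = 0 (possible only for
   |nu| < 2 rho_max) no sign makes the objective positive, and + is taken. *)
Definition mssa_scale (gamma : 'cV[R]_(n * L)) (l nu : R) : R :=
  let u := mssa_direction gamma nu in
  (if 0 <= bform It gamma u then 1 else -1) * Num.sqrt (l / bform It u u).

Definition mssa_filter (gamma : 'cV[R]_(n * L)) (l nu : R) : 'cV[R]_(n * L) :=
  mssa_scale gamma l nu *: mssa_direction gamma nu.

(* The factor linking the derivatives of the target correlation and of the
   autocorrelation: the length of N^-1 It gamma relative to that of gamma, both in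
   the norm x |-> sqrt (x' It x) in which the two correlations are normalized.
   The Euclidean variant
     sqrt (gamma' It' N^-2 It gamma) / sqrt (gamma' It' It gamma)
   agrees with it for Sigma = 1, but not in general: if n = 1 and Sigma = s, the
   Euclidean variant is 1/s times this factor, whereas both correlations, as
   functions of nu, do not depend on s. *)
Definition corr_gain (gamma : 'cV[R]_(n * L)) (nu : R) : R :=
  Num.sqrt (bform (It^T *m (invmx (Nmx nu))^T *m It *m invmx (Nmx nu) *m It)
                  gamma gamma) /
  Num.sqrt (bform It gamma gamma).

Definition euclidean_corr_gain (gamma : 'cV[R]_(n * L)) (nu : R) : R :=
  Num.sqrt (bform (It^T *m ((invmx (Nmx nu))^T *m invmx (Nmx nu)) *m It)
                  gamma gamma) /
  Num.sqrt (bform (It^T *m It) gamma gamma).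

End mssa.

(* Main.v *)
(* In the orthonormal basis vtilde k j both Itilde and Mtilde are diagonal, so with
   s_k = sum_j sigma_j w_kj^2 > 0 and p_k = 1 / (2 lambda_k - nu) every quadratic
   form in gamma and N^-1 Itilde gamma is a moment mom q = sum_k s_k p_k^q. In
   particular rho = mom 1 / (2 mom 2) + nu / 2, and up to sign the target
   correlation is mom 1 / sqrt (mom 0 * mom 2). For |nu| > 2 rho_max all p_k have
   the same sign, and Chebyshev's sum identity gives both rho' < 0, in the form
   (mom 2)^2 < mom 1 * mom 3, and the position of rho relative to rho_mse.
   Every admissible rho_i other than rho_mse is attained at some |nu| > 2 rho_max.
   There N is definite, and completing the square in N shows that the filter
   b(nu) is the unique solution of the M-SSA problem. *)
Require Import Defs.
From mathcomp Require Import all_boot all_order all_algebra.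
From mathcomp Require Import all_classical all_reals all_analysis.
From mathcomp Require Import ring lra.
Set Implicit Arguments.
Unset Strict Implicit.
Unset Printing Implicit Defensive.
Import Order.TTheory GRing.Theory Num.Theory.
Import numFieldNormedType.Exports.
Local Open Scope classical_set_scope.
Local Open Scope ring_scope.

(** * Moments of the poles *)

Lemma psumr_gt0_witness (R : numDomainType) (I : finType) (F : I -> R) (i0 : I) :
  (forall i, 0 <= F i) -> 0 < F i0 -> 0 < \sum_i F i.
Proof.
move=> F0 Fi0; rewrite (bigD1 i0)//=; apply: ltr_wpDr => //.
exact: sumr_ge0.
Qed.

(** Expanding [(f k - f m) * (g k - g m)], the two diagonal products each give the first term and
    the two cross products each give the second. [dbl] and [dbl'] expand a product of sums in the
    two index orders, so that the identity holds term by term. *)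
Lemma chebyshev_sum (R : comPzRingType) (I : finType) (s f g : I -> R) :
  \sum_k \sum_m s k * s m * ((f k - f m) * (g k - g m)) =
  ((\sum_k s k) * (\sum_k s k * (f k * g k))
   - (\sum_k s k * f k) * (\sum_k s k * g k)) *+ 2.
Proof.
have dbl (x y : I -> R) :
    (\sum_k x k) * (\sum_k y k) = \sum_k \sum_m x k * y m.
  by rewrite big_distrl/=; apply: eq_bigr => k _; rewrite big_distrr.
have dbl' (x y : I -> R) :
    (\sum_k x k) * (\sum_k y k) = \sum_k \sum_m x m * y k.
  by rewrite dbl exchange_big.
rewrite mulrnBl !mulr2n {1}dbl dbl' {1}dbl dbl' -!big_split -sumrB/=.
apply: eq_bigr => k _; rewrite -!big_split -sumrB/=.
by apply: eq_bigr => m _; ring.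
Qed.

(** One strictly positive pair makes the double sum of [chebyshev_sum] positive. Signs are asked
    only of the products, so the weights may also be all negative, which [moment_gap] exploits. *)
Lemma chebyshev_lt (R : realDomainType) (I : finType) (s f g : I -> R) (k0 m0 : I) :
  (forall k m, 0 <= s k * s m * ((f k - f m) * (g k - g m))) ->
  0 < s k0 * s m0 * ((f k0 - f m0) * (g k0 - g m0)) ->
  (\sum_k s k * f k) * (\sum_k s k * g k) <
  (\sum_k s k) * (\sum_k s k * (f k * g k)).
Proof.
move=> ge0 gt0; rewrite -subr_gt0 -(pmulrn_lgt0 _ (n := 2))//.
rewrite -chebyshev_sum; apply: (psumr_gt0_witness (i0 := k0)).
  by move=> k; exact: sumr_ge0.
exact: (psumr_gt0_witness (i0 := m0)).
Qed.

Definition pole (R : fieldType) (a nu : R) : R := (2 * a - nu)^-1.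

Definition moment (R : fieldType) (L : nat) (s a : 'I_L -> R) (q : nat) (nu : R) : R :=
  \sum_(k < L) s k * pole (a k) nu ^+ q.

Section moments.
Context (R : realType) (L : nat) (s a : 'I_L -> R) (m : R) (kmax kmin : 'I_L).
Hypotheses (s_gt0 : forall k, 0 < s k) (a_bnd : forall k, `|a k| <= m).
Hypotheses (m_gt0 : 0 < m) (a_max : a kmax = m) (a_min : a kmin = - m).

Local Notation p := (fun nu k => pole (a k) nu).
Local Notation mom := (moment s a).

(** Beyond [2 * m] in modulus, [nu] dominates every [2 * a k], so all denominators have the sign of
    [- nu]. The factor [- Num.sg nu] treats both half-lines at once. *)
Lemma pole_sg (nu : R) k : 2 * m < `|nu| -> 0 < - Num.sg nu * pole (a k) nu.
Proof.
move=> h; have := a_bnd k; rewrite ler_norml => /andP[a1 a2].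
rewrite /pole; case: (ltrgtP nu 0) h => [n0|n0|->].
- by rewrite ltr0_norm// ltr0_sg// opprK mul1r invr_gt0; lra.
- by rewrite gtr0_norm// gtr0_sg// mulN1r oppr_gt0 invr_lt0; lra.
- by rewrite normr0; lra.
Qed.

Lemma pole_neq0 (nu : R) k : 2 * m < `|nu| -> 2 * a k - nu != 0.
Proof.
(* A zero denominator would give a zero pole, since the inverse of 0 is 0, against the strict
   sign. *)
move=> /(pole_sg k); rewrite /pole; apply: contraTneq => ->.
by rewrite invr0 mulr0 ltxx.
Qed.

Lemma pole_mul_gt0 (nu : R) k j : 2 * m < `|nu| -> 0 < pole (a k) nu * pole (a j) nu.
Proof.
move=> h; have := mulr_gt0 (pole_sg k h) (pole_sg j h).
have : Num.sg nu ^+ 2 = 1.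
  have nu0 : nu != 0.
    by apply: contraTneq h => ->; rewrite normr0 -leNgt mulr_ge0// ltW.
  by rewrite sqr_sg nu0.
by rewrite mulrACA mulrNN -expr2 => ->; rewrite mul1r.
Qed.

(** As products of two poles are positive here, poles are ordered oppositely to the [a k]; this is
    the monotonicity that Chebyshev's identity needs. *)
Lemma poleB (nu : R) k j : 2 * m < `|nu| ->
  pole (a k) nu - pole (a j) nu =
  - 2 * (a k - a j) * (pole (a k) nu * pole (a j) nu).
Proof.
by move=> h; rewrite /pole; field; rewrite !pole_neq0.
Qed.

Lemma moment0E (nu : R) : mom 0 nu = \sum_k s k.
Proof. by apply: eq_bigr => k _; rewrite expr0 mulr1. Qed.

Lemma moment1_sg (nu : R) : 2 * m < `|nu| -> 0 < - Num.sg nu * mom 1 nu.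
Proof.
move=> h; rewrite /moment mulr_sumr; apply: (psumr_gt0_witness (i0 := kmax)).
  by move=> k; rewrite expr1 mulrCA ltW// mulr_gt0// pole_sg.
by rewrite expr1 mulrCA mulr_gt0// pole_sg.
Qed.

Lemma moment2_gt0 (nu : R) : (forall k, 2 * a k - nu != 0) -> 0 < mom 2 nu.
Proof.
move=> h; have pos k : 0 < s k * pole (a k) nu ^+ 2.
  by rewrite mulr_gt0// exprn_even_gt0//= /pole invr_neq0.
by apply: (psumr_gt0_witness (i0 := kmax)) => // k; exact: ltW.
Qed.

Lemma moment0_gt0 (nu : R) : 0 < mom 0 nu.
Proof.
apply: (psumr_gt0_witness (i0 := kmax)) => [k|]; rewrite expr0 mulr1//.
exact: ltW.
Qed.

(** Chebyshev with weights [s k * q k], all of one sign, and [f = g = q]. It is strict because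
    [kmax] and [kmin] have different poles. *)
Lemma moment_gap (nu : R) : 2 * m < `|nu| -> mom 2 nu ^+ 2 < mom 1 nu * mom 3 nu.
Proof.
move=> h; set q := p nu.
have qq k j : 0 < q k * q j by exact: pole_mul_gt0.
have e1 : mom 1 nu = \sum_k s k * q k.
  by apply: eq_bigr => k _; rewrite expr1.
have e2 : mom 2 nu = \sum_k s k * q k * q k.
  by apply: eq_bigr => k _; rewrite -mulrA expr2.
have e3 : mom 3 nu = \sum_k s k * q k * (q k * q k).
  by apply: eq_bigr => k _; rewrite /q -mulrA -expr2 -exprS.
rewrite expr2 e1 e2 e3.
have qe k j : s k * q k * (s j * q j) * ((q k - q j) * (q k - q j)) =
    s k * s j * (q k * q j) * (q k - q j) ^+ 2 by ring.
apply: (chebyshev_lt (k0 := kmax) (m0 := kmin)) => [k j|]; rewrite qe.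
  by rewrite mulr_ge0 ?sqr_ge0// ltW// mulr_gt0// mulr_gt0.
rewrite mulr_gt0//; first by rewrite mulr_gt0// mulr_gt0.
rewrite exprn_even_gt0//= poleB//; apply: mulf_neq0; last first.
  exact: lt0r_neq0 (qq kmax kmin).
have am : 0 < a kmax - a kmin by rewrite a_max a_min opprK addr_gt0.
by apply: mulf_neq0; rewrite ?(lt0r_neq0 am)// oppr_eq0 pnatr_eq0.
Qed.

(** Write [a k] as [((2 * a k - nu) + nu) / 2]: the bracket cancels one pole. The numerator of rho
    thus becomes a combination of moments, which can be differentiated. *)
Lemma weighted_moment (nu : R) : (forall k, 2 * a k - nu != 0) ->
  \sum_k a k * (s k * pole (a k) nu ^+ 2) = (mom 1 nu + nu * mom 2 nu) / 2.
Proof.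
move=> h; rewrite /moment mulr_sumr -big_split mulr_suml; apply: eq_bigr => k _ /=.
by rewrite /pole; field.
Qed.

(** Chebyshev with [f = e * a] and [g = q ^+ 2]. Factoring the difference of squares and applying
    [poleB] leaves [(a k - a j) ^+ 2] times [- e * (q k + q j)], which is positive by [pole_sg]. *)
Lemma weighted_mean_sg (nu : R) : 2 * m < `|nu| ->
  0 < Num.sg nu * ((\sum_k a k * (s k * pole (a k) nu ^+ 2)) * mom 0 nu
                   - (\sum_k a k * s k) * mom 2 nu).
Proof.
move=> h; set q := p nu; set e := Num.sg nu.
have qq k j : 0 < q k * q j by exact: pole_mul_gt0.
have qe k j : s k * s j * ((e * a k - e * a j) * (q k ^+ 2 - q j ^+ 2)) =
    s k * s j * (q k * q j) * (2 * (- e * q k + - e * q j) * (a k - a j) ^+ 2).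
  by rewrite (subr_sqr (q k)) poleB// /q; ring.
have := @chebyshev_lt _ _ s (fun k => e * a k) (fun k => q k ^+ 2) kmax kmin.
rewrite moment0E /moment -/q => H; rewrite mulrBr subr_gt0.
have -> : e * ((\sum_k a k * s k) * \sum_k s k * q k ^+ 2) =
    (\sum_k s k * (e * a k)) * (\sum_k s k * q k ^+ 2).
  rewrite mulrA; congr (_ * _); rewrite mulr_sumr.
  by apply: eq_bigr => k _; ring.
have -> : e * ((\sum_k a k * (s k * q k ^+ 2)) * \sum_k s k) =
    (\sum_k s k) * (\sum_k s k * (e * a k * q k ^+ 2)).
  rewrite mulrA mulrC; congr (_ * _); rewrite mulr_sumr.
  by apply: eq_bigr => k _; ring.
apply: H => [k j|]; rewrite qe.
  rewrite mulr_ge0//; first by rewrite ltW// mulr_gt0// mulr_gt0.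
  by rewrite mulr_ge0 ?sqr_ge0// mulr_ge0// addr_ge0// ltW// pole_sg.
rewrite mulr_gt0//; first by rewrite mulr_gt0// mulr_gt0.
rewrite mulr_gt0//; first by rewrite mulr_gt0// addr_gt0// pole_sg.
by rewrite exprn_even_gt0//= a_max a_min opprK lt0r_neq0// addr_gt0.
Qed.

End moments.

(** * Solving for a prescribed weighted mean outside the range of the poles *)

Section root.
Context (R : realType) (L : nat).

(* In the variable t = 1 / nu, clearing denominators leaves a polynomial that is
   negative at 0 and, at 1 / (2 m), reduces to its positive kmax term. *)
Lemma one_sided_root (s a : 'I_L -> R) (m r : R) (kmax : 'I_L) :
  (forall k, 0 < s k) -> (forall k, `|a k| <= m) -> 0 < m -> injective a ->
  a kmax = m -> r < m -> \sum_k s k * (a k - r) < 0 ->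
  exists2 nu, 2 * m < nu & \sum_k s k * (a k - r) * pole (a k) nu ^+ 2 = 0.
Proof.
move=> s0 am m0 a_inj amax rm neg.
have a_lt k : a k <= m by have := am k; rewrite ler_norml => /andP[].
pose P : {poly R} := \sum_k (s k * (a k - r))%:P *
  \prod_(j | j != k) (1 - (2 * a j)%:P * 'X) ^+ 2.
have PE t : P.[t] = \sum_k s k * (a k - r) * \prod_(j | j != k) (1 - 2 * a j * t) ^+ 2.
  rewrite horner_sum; apply: eq_bigr => k _.
  rewrite hornerM hornerC horner_prod; congr (_ * _); apply: eq_bigr => j _.
  by rewrite horner_exp hornerD hornerN hornerM !hornerC hornerX.
pose T := (2 * m)^-1; have T0 : 0 < T by rewrite invr_gt0 mulr_gt0.
have mT : 2 * m * T = 1 by rewrite /T mulfV// gt_eqF// mulr_gt0.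
have P0 : P.[0] < 0.
  rewrite PE (eq_bigr (fun k => s k * (a k - r)))// => k _.
  by rewrite big1 ?mulr1// => j _; rewrite mulr0 subr0 expr1n.
have PT : 0 < P.[T].
  rewrite PE (bigD1 kmax)//= [X in _ + X]big1 ?addr0; last first.
    move=> k kk; rewrite (bigD1 kmax) 1?eq_sym//= amax mT subrr expr0n/=.
    by rewrite mul0r mulr0.
  apply: mulr_gt0; first by rewrite amax mulr_gt0// subr_gt0.
  (* By injectivity only [kmax] reaches the value [m], so no other factor vanishes at [T]. *)
  apply: prodr_gt0 => j jk; rewrite exprn_even_gt0//= subr_eq0 -{1}mT.
  rewrite -subr_eq0 -mulrBl mulf_neq0 ?gt_eqF// subr_gt0 ltr_pM2l//.
  rewrite lt_neqAle a_lt andbT -amax.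
  by apply: contraNneq jk => /a_inj ->.
have [t /andP[t0 tT] /rootP Pt] := @poly_ivt _ P 0 T (ltW T0) ltac:(by rewrite !ltW).
have {t0} t_gt0 : 0 < t.
  by rewrite lt_neqAle t0 andbT; apply/eqP => e; move: Pt P0; rewrite -e => ->; rewrite ltxx.
have {tT} t_lt : t < T.
  by rewrite lt_neqAle tT andbT; apply/eqP => e; move: Pt PT; rewrite e => ->; rewrite ltxx.
have mt : 2 * m * t < 1 by rewrite -[ltRHS]mT ltr_pM2l// mulr_gt0.
have den k : 1 - 2 * a k * t != 0.
  by rewrite gt_eqF// subr_gt0 (le_lt_trans _ mt)// ler_pM2r// ler_pM2l.
exists t^-1; first by rewrite -[X in _ < X]div1r ltr_pdivlMr.
(* Restoring the denominators: [2 * a k - t^-1] equals [- (1 - 2 * a k * t) / t], so the sum is a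
   multiple of [P.[t]]. *)
have -> : \sum_k s k * (a k - r) * pole (a k) t^-1 ^+ 2 =
    t ^+ 2 / (\prod_j (1 - 2 * a j * t) ^+ 2) * P.[t]; last by rewrite Pt mulr0.
rewrite PE mulr_sumr; apply: eq_bigr => k _.
rewrite (bigD1 k)//=; set Q := \prod_(_ | _) _.
have Q0 : Q != 0 by apply/prodf_neq0 => j _; rewrite expf_neq0.
have h : 2 * a k - t^-1 = - (1 - 2 * a k * t) / t by field; rewrite gt_eqF.
by rewrite /pole h; field; rewrite Q0 (gt_eqF t_gt0)/= den.
Qed.

(** The sign of the centred sum at infinite [nu] selects the half-line that contains the root; a
    zero sum is excluded by the condition on [r]. *)
Lemma weighted_mean_root (s a : 'I_L -> R) (m r : R) (kmax kmin : 'I_L) :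
  (forall k, 0 < s k) -> (forall k, `|a k| <= m) -> 0 < m -> injective a ->
  a kmax = m -> a kmin = - m -> `|r| < m ->
  \sum_k a k * s k != r * \sum_k s k ->
  exists2 nu, 2 * m < `|nu| &
    \sum_k a k * (s k * pole (a k) nu ^+ 2) = r * moment s a 2 nu.
Proof.
move=> s0 am m0 a_inj amax amin; rewrite ltr_norml => /andP[r1 r2] rne.
have sub0 : \sum_k s k * (a k - r) = \sum_k a k * s k - r * \sum_k s k.
  by rewrite mulr_sumr -sumrB; apply: eq_bigr => k _; ring.
have sub2 nu : \sum_k s k * (a k - r) * pole (a k) nu ^+ 2 =
    \sum_k a k * (s k * pole (a k) nu ^+ 2) - r * moment s a 2 nu.
  by rewrite mulr_sumr -sumrB; apply: eq_bigr => k _; ring.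
have [neg|pos|/eqP] := ltgtP (\sum_k s k * (a k - r)) 0; last first.
- by rewrite sub0 subr_eq0 (negPf rne).
(* The positive case reduces to the negative one by reflecting [a], [r] and [nu], which exchanges
   [kmax] and [kmin]. *)
- have [||||//|||nu nu1 nu2] := @one_sided_root s (fun k => - a k) m (- r) kmin.
  + by [].
  + by move=> k; rewrite normrN.
  + by [].
  + by move=> i j /oppr_inj /a_inj.
  + by rewrite amin opprK.
  + by rewrite ltrNl.
  + rewrite (eq_bigr (fun k => - (s k * (a k - r)))) => [|k _]; last ring.
    by rewrite sumrN oppr_lt0.
  exists (- nu); first by rewrite normrN (lt_le_trans nu1)// ler_norm.
  apply/eqP; rewrite -subr_eq0 -sub2 -oppr_eq0 -sumrN -[X in _ == X]nu2; apply/eqP.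
  apply: eq_bigr => k _; rewrite /pole.
  rewrite (_ : 2 * - a k - nu = - (2 * a k - - nu)); last ring.
  by rewrite invrN sqrrN; ring.
- have [nu nu1 nu2] := one_sided_root s0 am m0 a_inj amax r2 neg.
  exists nu; first by rewrite (lt_le_trans nu1)// ler_norm.
  by apply/eqP; rewrite -subr_eq0 -sub2 nu2.
Qed.

End root.

Lemma cvg_bigsum (R : realType) (T : Type) (F : set_system T) {FF : Filter F} (L : nat)
    (f : 'I_L -> T -> R) (l : 'I_L -> R) :
  (forall k, f k x @[x --> F] --> l k) ->
  \sum_k f k x @[x --> F] --> \sum_k l k.
Proof.
move=> fl.
suff : forall r : seq 'I_L,
    \sum_(k <- r) f k x @[x --> F] --> \sum_(k <- r) l k by exact.
elim=> [|k r ih].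
  by under eq_fun do rewrite big_nil; rewrite big_nil; exact: cvg_cst.
by under eq_fun do rewrite big_cons; rewrite big_cons; exact: cvgD.
Qed.

(** * Derivatives of moments and limits at infinity *)

Section calculus.
Context (R : realType) (L : nat) (s a : 'I_L -> R).
Local Notation mom := (moment s a).

(** The derivative of a pole in [nu] is its own square, so differentiation raises the order of a
    moment by one. *)
Lemma is_derive_moment q nu : (forall k, 2 * a k - nu != 0) ->
  is_derive (nu : R) (1 : R) (mom q : R -> R) (q%:R * mom q.+1 nu).
Proof.
move=> h.
have -> : mom q = \sum_(k < L) (s k \*: (fun x => pole (a k) x) ^+ q).
  apply/funext => x; rewrite /moment fct_sumE.
  by apply: eq_bigr => k _; rewrite /= exprfctE.
have dp k : is_derive nu (1 : R) (fun x => pole (a k) x) (pole (a k) nu ^+ 2).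
  have d1 : is_derive nu (1 : R) (fun x => 2 * a k - x) (0 - 1).
    exact: (@is_deriveB _ _ _ (cst (2 * a k)) id).
  apply: (is_derive_eq (@is_deriveV _ (fun x => 2 * a k - x) _ _ _ (h k) d1)).
  by rewrite /pole exprVn sub0r scaleNr scalerN opprK; exact: mulr1.
have dX k : is_derive nu (1 : R) (s k \*: (fun x => pole (a k) x) ^+ q)
    (s k *: ((q%:R * pole (a k) nu ^+ q.-1) *: pole (a k) nu ^+ 2)).
  exact: is_deriveZ.
apply: (is_derive_eq (is_derive_sum dX)).
rewrite mulr_sumr; apply: eq_bigr => k _.
case: q {dX} => [|q]; first by rewrite !mul0r scale0r scaler0.
have -> : pole (a k) nu ^+ q.+2 = pole (a k) nu ^+ q * pole (a k) nu ^+ 2.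
  by rewrite -exprD addn2.
rewrite [LHS](_ : _ = s k * (q.+1%:R * pole (a k) nu ^+ q * pole (a k) nu ^+ 2))//.
by ring.
Qed.

(** Scaling numerator and denominator by [x ^+ 2] leaves the quotient unchanged, and
    [x * pole (a k) x], which is [g k x], tends to -1. A general filter [F] serves both
    infinities. *)
Lemma cvg_weighted_mean (F : set_system R) {FF : ProperFilter F} :
  (forall k, 0 < s k) -> (0 < L)%N ->
  x^-1 @[x --> F] --> (0 : R) -> (\forall x \near F, x != 0) ->
  (\sum_k a k * (s k * pole (a k) x ^+ 2)) / mom 2 x @[x --> F] -->
  (\sum_k a k * s k) / \sum_k s k.
Proof.
move=> s0 L0 cV xn0.
pose g k (x : R) := (2 * a k * x^-1 - 1)^-1.
have cg k : g k x @[x --> F] --> (-1 : R).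
  rewrite -[-1 in X in _ --> X]invrN1 -[-1 in X in _ --> X]add0r.
  rewrite -[0 in X in _ --> X](mulr0 (2 * a k)).
  apply: cvgV; first by rewrite mulr0 add0r oppr_eq0 oner_eq0.
  by apply: cvgB; [apply: cvgM => //; exact: cvg_cst|exact: cvg_cst].
have cg2 k : g k x ^+ 2 @[x --> F] --> (1 : R).
  by rewrite -[1 in X in _ --> X]mulr1 -[1 * 1 in X in _ --> X]mulrNN; apply: cvgM.
have cn : (\sum_k a k * (s k * g k x ^+ 2)) / (\sum_k s k * g k x ^+ 2) @[x --> F] -->
    (\sum_k a k * (s k * 1)) / \sum_k s k * 1.
  apply: cvgM.
    apply: cvg_bigsum => k; apply: cvgM; first exact: cvg_cst.
    by apply: cvgM => //; exact: cvg_cst.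
  apply: cvgV.
    apply: lt0r_neq0; apply: (psumr_gt0_witness (i0 := Ordinal L0)) => [k|].
      by rewrite mulr1 ltW.
    by rewrite mulr1.
  by apply: cvg_bigsum => k; apply: cvgM => //; exact: cvg_cst.
rewrite (eq_bigr (fun k => a k * (s k * 1))) => [|k _]; last by rewrite mulr1.
rewrite [X in _ / X](eq_bigr (fun k => s k * 1)) => [|k _]; last by rewrite mulr1.
apply: cvg_trans cn; apply: near_eq_cvg; near=> x.
have x0 : x != 0 by near: x.
have gE k : g k x = x * pole (a k) x.
  rewrite /g /pole; have -> : 2 * a k * x^-1 - 1 = (2 * a k - x) / x by field.
  by rewrite invf_div.
rewrite /moment.
rewrite (eq_bigr (fun k => x ^+ 2 * (a k * (s k * pole (a k) x ^+ 2)))) => [|k _]; last first.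
  by rewrite gE; ring.
rewrite [X in _ / X](eq_bigr (fun k => x ^+ 2 * (s k * pole (a k) x ^+ 2))) => [|k _]; last first.
  by rewrite gE; ring.
by rewrite -!mulr_sumr -mulf_div divff ?mul1r// expf_neq0.
Unshelve. all: by end_near.
Qed.

Lemma cvg_inv_pinfty : x^-1 @[x --> +oo] --> (0 : R).
Proof.
by apply/gtr0_cvgV0; [near do by []|exact: cvg_id].
Unshelve. all: by end_near.
Qed.

Lemma cvg_inv_ninfty : x^-1 @[x --> -oo] --> (0 : R).
Proof.
by apply/ltr0_cvgV0; [near do by []|exact: cvg_id].
Unshelve. all: by end_near.
Qed.

End calculus.

(** * Spectral decompositions *)

Section bilinear.
Context (R : comPzRingType) (m : nat).
Implicit Types (A B : 'M[R]_m) (x y z : 'cV[R]_m).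

Lemma bformDl A x y z : bform A (x + y) z = bform A x z + bform A y z.
Proof. by rewrite /bform linearD/= !mulmxDl mxE. Qed.

Lemma bformZl A c x y : bform A (c *: x) y = c * bform A x y.
Proof. by rewrite /bform linearZ/= -!scalemxAl mxE. Qed.

Lemma bformDr A x y z : bform A x (y + z) = bform A x y + bform A x z.
Proof. by rewrite /bform mulmxDr mxE. Qed.

Lemma bformZr A c x y : bform A x (c *: y) = c * bform A x y.
Proof. by rewrite /bform -scalemxAr mxE. Qed.

Lemma bform_sumr (I : finType) A x (f : I -> 'cV[R]_m) :
  bform A x (\sum_i f i) = \sum_i bform A x (f i).
Proof. by rewrite /bform mulmx_sumr summxE. Qed.

Lemma bform_sumE A x y : bform A x y = \sum_i \sum_j x i 0 * A i j * y j 0.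
Proof.
rewrite /bform mxE exchange_big/=; apply: eq_bigr => j _.
by rewrite mxE mulr_suml; apply: eq_bigr => i _; rewrite mxE.
Qed.

Lemma bform1E x y : bform 1%:M x y = \sum_i x i 0 * y i 0.
Proof. by rewrite /bform mulmx1 mxE; apply: eq_bigr => i _; rewrite mxE. Qed.

Lemma bformC A x y : A^T = A -> bform A x y = bform A y x.
Proof.
move=> Asym; rewrite /bform -[RHS](mxE trmx_key (fun i j => (y^T *m A *m x) j i)).
by rewrite -/(trmx _) !trmx_mul trmxK Asym mulmxA.
Qed.

Lemma bform_sub_sym A x y : A^T = A ->
  bform A (x - y) (x - y) = bform A x x - 2 * bform A y x + bform A y y.
Proof.
move=> Asym; rewrite -scaleN1r !bformDl !bformZl !bformDr !bformZr.
by rewrite (bformC x y Asym); ring.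
Qed.

Lemma mulmx_trE n (x : 'cV[R]_m) (y : 'cV[R]_n) i j :
  (x *m y^T) i j = x i 0 * y j 0.
Proof. by rewrite mxE big_ord1 mxE. Qed.

(** The matrix with these columns is square, so its left inverse [V^T] is also a right inverse. *)
Lemma orthonormal_resolution (v : 'I_m -> 'cV[R]_m) :
  orthonormal_family v -> \sum_i v i *m (v i)^T = 1%:M.
Proof.
move=> vo; pose V := \matrix_(r, i) v i r 0.
have VV : V^T *m V = 1%:M.
  apply/matrixP => i j; rewrite !mxE -vo bform1E.
  by apply: eq_bigr => r _; rewrite !mxE.
rewrite -(mulmx1C VV); apply/matrixP => i j; rewrite summxE mxE.
by apply: eq_bigr => k _; rewrite mulmx_trE !mxE.
Qed.

End bilinear.

Section spectral_family.
Context (R : fieldType) (m : nat) (I : finType) (v : I -> 'cV[R]_m).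
Hypothesis v_res : \sum_i v i *m (v i)^T = 1%:M.

(** Insert the resolution of the identity between [A] and [y], and let [A] act on each [v i]. *)
Lemma bform_spectral (A : 'M[R]_m) (mu : I -> R) (x y : 'cV[R]_m) :
  (forall i, A *m v i = mu i *: v i) ->
  bform A x y = \sum_i mu i * (bform 1%:M (v i) x * bform 1%:M (v i) y).
Proof.
move=> Av; rewrite [LHS]/bform -[A in LHS]mulmx1 -[1%:M in LHS]v_res.
rewrite !mulmx_sumr mulmx_suml summxE; apply: eq_bigr => i _.
rewrite (mulmxA A) Av -scalemxAl -scalemxAr -scalemxAl mxE; congr (_ * _).
rewrite (mulmxA x^T) -(mulmxA (x^T *m v i)) mxE big_ord1 /bform !mulmx1; congr (_ * _).
by rewrite -[x^T *m v i]trmxK trmx_mul trmxK mxE.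
Qed.

Lemma spectral_expansion (x : 'cV[R]_m) : x = \sum_i bform 1%:M (v i) x *: v i.
Proof.
rewrite -[LHS]mul1mx -[1%:M in LHS]v_res mulmx_suml; apply: eq_bigr => i _.
by rewrite -mulmxA [(v i)^T *m x]mx11_scalar mul_mx_scalar /bform mulmx1.
Qed.

(** The inverse is explicit: the same rank-one terms, weighted by the inverse eigenvalues. *)
Lemma spectral_unitmx (A : 'M[R]_m) (mu : I -> R) :
  (forall i, A *m v i = mu i *: v i) -> (forall i, mu i != 0) -> A \in unitmx.
Proof.
move=> Av mu0; apply: (proj1 (mulmx1_unit (_ : A *m
  (\sum_i (mu i)^-1 *: (v i *m (v i)^T)) = 1%:M))).
rewrite mulmx_sumr -v_res; apply: eq_bigr => i _.
by rewrite -scalemxAr mulmxA Av -scalemxAl scalerA mulVf// scale1r.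
Qed.

End spectral_family.

Lemma invmx_eigen (R : fieldType) (m : nat) (A : 'M[R]_m) (v : 'cV[R]_m) (mu : R) :
  A \in unitmx -> mu != 0 -> A *m v = mu *: v -> invmx A *m v = mu^-1 *: v.
Proof.
move=> Au mu0 Av; apply: (scalerI mu0).
by rewrite scalerA mulfV// scale1r scalemxAr -Av mulKmx.
Qed.

Lemma tensmx11 (R : pzRingType) (n L : nat) :
  (1%:M : 'M[R]_n) *t (1%:M : 'M[R]_L) = 1%:M.
Proof.
apply/matrixP => r s.
rewrite -[r]mxtens_unindexK -[s]mxtens_unindexK.
case: (mxtens_unindex r) => i j; case: (mxtens_unindex s) => k l.
rewrite tensmxE !mxE (inj_eq (can_inj (@mxtens_indexK n L))) xpair_eqE.
by rewrite -natrM mulnb.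
Qed.

(** * Spectrum of the tridiagonal matrix M *)

Section sine_basis.
Context (R : realType) (L : nat).
Implicit Types k : 'I_L.

Local Notation theta k := ((k.+1)%:R * pi / L.+1%:R : R).

Lemma theta_itv k : 0 < theta k < pi.
Proof.
rewrite divr_gt0 ?mulr_gt0 ?pi_gt0//= ltr_pdivrMr// mulrC ltr_pM2l ?pi_gt0//.
by rewrite ltr_nat ltnS.
Qed.

Lemma lambda_inj : injective (@lambda R L).
Proof.
move=> i j /cos_inj; rewrite !in_itv/=.
have /andP[i1 i2] := theta_itv i; have /andP[j1 j2] := theta_itv j.
rewrite !ltW// => /(_ isT isT) /(mulIf _) h.
have /h{h} : (L.+1%:R^-1 : R) != 0 by rewrite invr_eq0 pnatr_eq0.
by move=> /(mulIf (lt0r_neq0 (pi_gt0 R)))/eqP; rewrite eqr_nat eqSS => /eqP/val_inj.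
Qed.

(** Reversing the index replaces the angle by its supplement. Hence the spectrum is symmetric and
    its least element is [- rho_max L]. *)
Lemma lambda_rev k : lambda (rev_ord k) = - lambda k :> R.
Proof.
rewrite /lambda -[in RHS](cosN (theta k)) -cosDpi; congr cos.
rewrite /= subnSK// natrB 1?ltnW// -[RHS]addrC.
by field; rewrite addrC natr1 pnatr_eq0.
Qed.

Lemma lambda_le_max k : lambda k <= rho_max L :> R.
Proof.
have /andP[k1 k2] := theta_itv k.
have h1 : pi / L.+1%:R <= theta k.
  by rewrite ler_pM2r ?invr_gt0// ler_pMl ?pi_gt0// ler1n.
have h0 : 0 <= pi / L.+1%:R :> R by rewrite divr_ge0// ltW// pi_gt0.
rewrite /lambda /rho_max leNgt ltr_cos ?in_itv/= -?leNgt// ?h0 ?ltW//=.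
by rewrite (le_lt_trans h1).
Qed.

Lemma lambda_norm_le k : `|lambda k| <= rho_max L :> R.
Proof.
by rewrite ler_norml lambda_le_max lerNl -lambda_rev lambda_le_max.
Qed.

Lemma lambda_first k : k = 0%N :> nat -> lambda k = rho_max L :> R.
Proof. by move=> k0; rewrite /lambda k0 mul1r. Qed.

Lemma sum_ord_delta (f : nat -> R) (c : nat) :
  \sum_(j < L) (if j == c :> nat then f j else 0) = if (c < L)%N then f c else 0.
Proof.
rewrite -big_mkcond/=; case: ltnP => cL.
  by rewrite (big_pred1 (Ordinal cL)).
by rewrite big1// => j /eqP jc; have := ltn_ord j; rewrite jc ltnNge cL.
Qed.

(** Each row is half the sum of two neighbouring sines, hence the cosine of the step times the
    middle sine by the addition formulas. The sine vanishes at positions 0 and L + 1, so the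
    boundary rows obey the same rule. *)
Lemma Mmx_sine_vec k : Mmx R L *m sine_vec R k = lambda k *: sine_vec R k.
Proof.
pose f (j : nat) : R := 2^-1 * sin (j.+1%:R * theta k).
have fE (j : 'I_L) : 2^-1 * sine_vec R k j 0 = f j.
  by rewrite mxE /f natrM !mulrA.
apply/colP => i; rewrite [RHS]mxE mxE.
rewrite (eq_bigr (fun j : 'I_L => (if j == i.+1 :> nat then f j else 0) +
    (if j.+1 == i :> nat then f j else 0))); last first.
  move=> j _; rewrite mxE -fE [i.+1 == j]eq_sym.
  have [->|ji] := eqVneq (j : nat) i.+1; last first.
    by rewrite /= add0r; case: ifP => _ //; rewrite mul0r.
  by rewrite /= gtn_eqF ?addr0// ltnS leqW.
rewrite big_split/= sum_ord_delta.
(* In the last row the missing right neighbour would be the sine of a multiple of pi. *)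
have -> : (if (i.+1 < L)%N then f i.+1 else 0) = f i.+1.
  case: ltnP => // Li; have {}Li : i.+1 = L by apply/eqP; rewrite eqn_leq Li ltn_ord.
  rewrite /f Li (_ : _ * _ = k.+1%:R * pi); last by field; rewrite addrC natr1 pnatr_eq0.
  suff -> : sin (k.+1%:R * pi) = 0 :> R by rewrite mulr0.
  elim: (k.+1) => [|a ih]; first by rewrite mul0r sin0.
  by rewrite -natr1 mulrDl mul1r sinDpi ih oppr0.
(* In the first row the missing left neighbour would be sin 0. *)
have -> : \sum_(j < L) (if j.+1 == i :> nat then f j else 0) = 2^-1 * sin (i%:R * theta k).
  case: i => [[|i] iL]/=; first by rewrite mul0r sin0 mulr0 big1.
  by under eq_bigr do rewrite eqSS; rewrite sum_ord_delta ltnW.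
have -> : sine_vec R k i 0 = sin (i.+1%:R * theta k) by rewrite mxE natrM !mulrA.
rewrite /f /lambda; set t := theta k.
have -> : i.+2%:R * t = i.+1%:R * t + t by rewrite -natr1 mulrDl mul1r.
have -> : i%:R * t = i.+1%:R * t - t by rewrite -natr1 mulrDl mul1r addrK.
by rewrite sinB sinD; field.
Qed.

Lemma Mvec_eigen k : Mmx R L *m Mvec R k = lambda k *: Mvec R k.
Proof. by rewrite -scalemxAr Mmx_sine_vec !scalerA mulrC. Qed.

Lemma trmx_Mmx : (Mmx R L)^T = Mmx R L.
Proof. by apply/matrixP => i j; rewrite !mxE orbC. Qed.

(** The first sine entry has its angle strictly between 0 and pi, so the norm is nonzero.
    Orthogonality comes from distinct eigenvalues of a symmetric matrix. *)
Lemma Mvec_orthonormal : orthonormal_family (@Mvec R L).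
Proof.
move=> i j; have [<-|ij] := eqVneq i j.
  have L0 : (0 < L)%N by exact: leq_ltn_trans (ltn_ord i).
  rewrite /Mvec bformZl bformZr; set q := bform _ _ _.
  have q0 : 0 < q.
    rewrite /q bform1E; apply: (psumr_gt0_witness (i0 := Ordinal L0)) => [r|].
      by rewrite -expr2 sqr_ge0.
    by rewrite mxE mul1n -expr2 exprn_even_gt0//= lt0r_neq0// sin_gt0_pi// theta_itv.
  rewrite mulrA -expr2 exprVn sqr_sqrtr ?ltW// mulVf// lt0r_neq0//.
have h : (lambda i - lambda j) * bform 1%:M (Mvec R i) (Mvec R j) = 0.
  rewrite mulrBl -bformZl -bformZr -!Mvec_eigen /bform !mulmx1 trmx_mul trmx_Mmx.
  by rewrite mulmxA subrr.
move/eqP: h; rewrite mulf_eq0 subr_eq0 => /orP[/eqP/lambda_inj/eqP|/eqP//].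
by rewrite (negPf ij).
Qed.

End sine_basis.

Lemma tensmx_eigen (R : comPzRingType) (n L : nat) (S : 'M[R]_n) (A : 'M[R]_L)
    (x : 'cV[R]_n) (y : 'cV[R]_L) (a b : R) :
  S *m x = a *: x -> A *m y = b *: y ->
  (S *t A) *m (x *t y) = (a * b) *: (x *t y).
Proof.
move=> Sx Ay; rewrite tensmx_mul Sx Ay; apply/matrixP => i j.
by rewrite !mxE mulrACA.
Qed.

Lemma vtilde_mxtensE (R : realType) (n L : nat) (vsigma : 'I_n -> 'cV[R]_n)
    (k : 'I_L) (j : 'I_n) (p : 'I_n * 'I_L) :
  vtilde vsigma k j (mxtens_index p) 0 = vsigma j p.1 0 * Mvec R k p.2 0.
Proof. by rewrite mxE mxtens_indexK !ord1. Qed.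

Lemma mxtens_index_bij (n L : nat) (P : pred 'I_(n * L)) :
  {on P, bijective (@mxtens_index n L)}.
Proof.
apply: onW_bij; exists (@mxtens_unindex n L); [exact: mxtens_indexK|].
exact: mxtens_unindexK.
Qed.

(** * The tensor eigenbasis and coordinates in it *)

Section tensor_basis.
Context (R : realType) (n L : nat) (Sigma : 'M[R]_n).
Context (sigma : 'I_n -> R) (vsigma : 'I_n -> 'cV[R]_n).
Hypothesis heig : forall j, Sigma *m vsigma j = sigma j *: vsigma j.
Hypothesis horth : orthonormal_family vsigma.

Local Notation V := (fun p : 'I_L * 'I_n => vtilde vsigma p.1 p.2).
Local Notation It := (Itilde L Sigma).
Local Notation Mt := (Mtilde L Sigma).

(** Entrywise, the sum over pairs factors into the resolutions of the two tensor components. *)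
Lemma vtilde_resolution : \sum_p V p *m (V p)^T = 1%:M.
Proof.
apply/matrixP => r s; rewrite summxE.
rewrite -[r]mxtens_unindexK -[s]mxtens_unindexK.
case: (mxtens_unindex r) => i k; case: (mxtens_unindex s) => j l.
transitivity ((\sum_q Mvec R q *m (Mvec R q)^T) k l *
              (\sum_q vsigma q *m (vsigma q)^T) i j).
  rewrite !summxE big_distrlr/= pair_bigA; apply: eq_bigr => -[q t] _ /=.
  by rewrite !mulmx_trE !vtilde_mxtensE/=; ring.
rewrite !orthonormal_resolution//; last exact: Mvec_orthonormal.
by rewrite -tensmx11 tensmxE mulrC.
Qed.

Lemma vtilde_orthonormal : orthonormal_family V.
Proof.
move=> [k i] [l j] /=; rewrite bform1E (reindex _ (mxtens_index_bij _))/=.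
transitivity (bform 1%:M (vsigma i) (vsigma j) * bform 1%:M (Mvec R k) (Mvec R l)).
  rewrite !bform1E big_distrlr/= pair_bigA; apply: eq_bigr => -[q t] _ /=.
  by rewrite !vtilde_mxtensE mulrACA.
by rewrite horth Mvec_orthonormal xpair_eqE -natrM mulnb andbC.
Qed.

Lemma Itilde_eigen p : It *m V p = sigma p.2 *: V p.
Proof.
rewrite -[sigma p.2]mulr1; apply: tensmx_eigen; first exact: heig.
by rewrite mul1mx scale1r.
Qed.

Lemma Mtilde_eigen p : Mt *m V p = (sigma p.2 * lambda p.1) *: V p.
Proof. by apply: tensmx_eigen; [exact: heig|exact: Mvec_eigen]. Qed.

Lemma Nmx_eigen nu p :
  Nmx L Sigma nu *m V p = (sigma p.2 * (2 * lambda p.1 - nu)) *: V p.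
Proof.
rewrite /Nmx mulmxBl -!scalemxAl Itilde_eigen Mtilde_eigen !scalerA -scalerBl.
by congr (_ *: _); ring.
Qed.

(** The vector with prescribed spectral weights: [w] gives gamma, and rescaled weights give the
    M-SSA direction, so quadratic forms can be read off from weight arrays. *)
Definition synth (f : 'I_L -> 'I_n -> R) : 'cV[R]_(n * L) :=
  \sum_(k < L) \sum_(j < n) f k j *: vtilde vsigma k j.

Lemma synthE f : synth f = \sum_p f p.1 p.2 *: V p.
Proof. by rewrite /synth pair_bigA. Qed.

Lemma coord_synth f p : bform 1%:M (V p) (synth f) = f p.1 p.2.
Proof.
rewrite synthE bform_sumr (bigD1 p)//= big1 ?addr0 => [|q qp].
  by rewrite bformZr (vtilde_orthonormal p p) eqxx mulr1.
by rewrite bformZr (vtilde_orthonormal p q) eq_sym (negPf qp) mulr0.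
Qed.

Lemma bform_It_synth f g :
  bform It (synth f) (synth g) = \sum_k \sum_j sigma j * (f k j * g k j).
Proof.
rewrite (bform_spectral vtilde_resolution _ _ Itilde_eigen) pair_bigA.
by apply: eq_bigr => p _; rewrite !coord_synth.
Qed.

Lemma bform_Mt_synth f g :
  bform Mt (synth f) (synth g) =
  \sum_k lambda k * \sum_j sigma j * (f k j * g k j).
Proof.
rewrite (bform_spectral vtilde_resolution _ _ Mtilde_eigen).
under [RHS]eq_bigr do rewrite mulr_sumr.
rewrite pair_bigA; apply: eq_bigr => p _.
by rewrite !coord_synth mulrA [lambda _ * _]mulrC.
Qed.

Hypothesis sigma_neq0 : forall j, sigma j != 0.

Lemma Nmx_unitmx nu : admissible L nu -> Nmx L Sigma nu \in unitmx.
Proof.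
move=> adm; apply: (spectral_unitmx vtilde_resolution (Nmx_eigen nu)) => p.
by rewrite mulf_neq0// subr_eq0 eq_sym.
Qed.

(** [Itilde] multiplies a coordinate by [sigma j], and the inverse of N divides it by
    [sigma j * (2 * lambda k - nu)]. The [sigma j] cancel and only the pole remains. *)
Lemma mssa_direction_synth (w : 'I_L -> 'I_n -> R) nu : admissible L nu ->
  mssa_direction Sigma (synth w) nu =
  synth (fun k j => pole (lambda k) nu * w k j).
Proof.
move=> adm; rewrite /mssa_direction -mulmxA !synthE !mulmx_sumr.
apply: eq_bigr => p _; rewrite -!scalemxAr Itilde_eigen -scalemxAr.
have d0 : 2 * lambda p.1 - nu != 0 by rewrite subr_eq0 eq_sym.
rewrite (invmx_eigen (Nmx_unitmx adm) _ (Nmx_eigen nu p)) ?mulf_neq0// !scalerA.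
by congr (_ *: _); rewrite /pole; field; rewrite sigma_neq0 d0.
Qed.

End tensor_basis.

(** The eigenvalue is the quadratic form at a unit eigenvector, hence nonnegative; if it were zero,
    invertibility of [Sigma] would force the eigenvector to vanish. *)
Lemma covariance_eigenvalue_gt0 (R : realType) (n : nat) (Sigma : 'M[R]_n)
    (sigma : 'I_n -> R) (vsigma : 'I_n -> 'cV[R]_n) :
  covariance_matrix Sigma -> \rank Sigma = n ->
  (forall j, Sigma *m vsigma j = sigma j *: vsigma j) ->
  orthonormal_family vsigma -> forall j, 0 < sigma j.
Proof.
move=> [_ psd] rk heig horth j.
have vv : bform 1%:M (vsigma j) (vsigma j) = 1 by rewrite horth eqxx.
have := psd (vsigma j).
have -> : bform Sigma (vsigma j) (vsigma j) = sigma j.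
  by rewrite /bform -mulmxA heig -scalemxAr mxE -[RHS]mulr1 -vv /bform mulmx1.
rewrite le_eqVlt => /orP[/eqP s0|//].
have Su : Sigma \in unitmx by rewrite -row_free_unit /row_free rk.
have v0 : vsigma j = 0 by rewrite -(mulKmx Su (vsigma j)) heig -s0 scale0r mulmx0.
by move: vv; rewrite v0 /bform mulmx0 mxE => /esym/eqP; rewrite oner_eq0.
Qed.

(** * Covariances of filter outputs *)

Section covariance_sums.
Context {d : measure_display} {T : measurableType d} {R : realType}.
Context (P : probability T R).

Lemma Lfun_lincomb (I : finType) (c : I -> R) (X : I -> T -> R) :
  (forall i, X i \in Lfun P 2%:E) ->
  (fun x => \sum_i c i * X i x) \in Lfun P 2%:E.
Proof.
move=> X2.
have -> : (fun x => \sum_i c i * X i x) = \sum_i (c i \o* X i)%R.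
  by apply/funext => x; rewrite fct_sumE; apply: eq_bigr => i _ /=; rewrite mulrC.
have p1 : (1 <= 2%:E :> \bar R)%E by rewrite lee_fin ler1n.
by apply: rpred_sum => i _; apply: Lfun_scale => //; rewrite ler1n.
Qed.

Lemma covariance_lincombl (I : finType) (c : I -> R) (X : I -> T -> R)
    (Z : T -> R) (K : I -> R) :
  (forall i, X i \in Lfun P 2%:E) -> Z \in Lfun P 2%:E ->
  (forall i, covariance P (X i) Z = (K i)%:E) ->
  covariance P (fun x => \sum_i c i * X i x) Z = (\sum_i c i * K i)%:E.
Proof.
move=> X2 Z2 XZ.
have Pfin : P setT \is a fin_num := fin_num_measure P _ measurableT.
have p1 : (1 <= 2%:E :> \bar R)%E by rewrite lee_fin ler1n.
have L1 := Lfun_subset12 Pfin.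
have cX2 i : (c i \o* X i)%R \in Lfun P 2%:E by apply: Lfun_scale => //; rewrite ler1n.
have covZ i : covariance P (c i \o* X i)%R Z = (c i * K i)%:E.
  by rewrite covarianceZl ?XZ ?EFinM//; [exact: L1|exact: L1|exact: Lfun2_mul_Lfun1].
have -> : (fun x => \sum_i c i * X i x) = \sum_i (c i \o* X i)%R.
  by apply/funext => x; rewrite fct_sumE; apply: eq_bigr => i _ /=; rewrite mulrC.
suff : forall r : seq I, covariance P (\sum_(i <- r) (c i \o* X i)%R) Z =
  (\sum_(i <- r) c i * K i)%:E by exact.
elim=> [|i r ih]; first by rewrite !big_nil; exact: (covariance_cst_l P 0).
rewrite !big_cons EFinD -ih -covZ; apply: covarianceDl => //.
by apply: rpred_sum.
Qed.

Lemma covariance_lincomb (I : finType) (c : I -> R) (X Y : I -> T -> R)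
    (K : I -> I -> R) :
  (forall i, X i \in Lfun P 2%:E) -> (forall i, Y i \in Lfun P 2%:E) ->
  (forall i j, covariance P (X i) (Y j) = (K i j)%:E) ->
  covariance P (fun x => \sum_i c i * X i x) (fun x => \sum_i c i * Y i x) =
  (\sum_i \sum_j c i * K i j * c j)%:E.
Proof.
move=> X2 Y2 XY.
rewrite (@covariance_lincombl _ c X _ (fun i => \sum_j c j * K i j))//.
- congr EFin; apply: eq_bigr => i _; rewrite mulr_sumr.
  by apply: eq_bigr => j _; ring.
- exact: Lfun_lincomb.
- move=> i; rewrite covarianceC (@covariance_lincombl _ c Y _ (K i))//.
  by move=> j; rewrite covarianceC.
Qed.

End covariance_sums.

Section filters.
Context {d : measure_display} {T : measurableType d} {R : realType}.
Context (P : probability T R) (n L : nat) (Sigma : 'M[R]_n).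
Context (eps : int -> 'I_n -> {RV P >-> R}).
Hypothesis heps : white_noise Sigma eps.
Hypothesis hsym : Sigma^T = Sigma.

Lemma bform_tens (A : 'M[R]_L) (b : 'cV[R]_(n * L)) :
  bform (Sigma *t A) b b = \sum_(p : 'I_n * 'I_L) \sum_(q : 'I_n * 'I_L)
    b (mxtens_index p) 0 * (Sigma p.1 q.1 * A p.2 q.2) * b (mxtens_index q) 0.
Proof.
have bij : {on [pred _ : 'I_(n * L) | true], bijective (@mxtens_index n L)}.
  by apply: onW_bij; exists (@mxtens_unindex n L);
    [exact: mxtens_indexK|exact: mxtens_unindexK].
rewrite bform_sumE (reindex _ bij)/=; apply: eq_bigr => -[i k] _.
rewrite (reindex _ bij)/=; apply: eq_bigr => -[j l] _.
by rewrite tensmxE.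
Qed.

Lemma filter_covariance (b : 'cV[R]_(n * L)) (s t : int) :
  covariance P (filter_output eps b s) (filter_output eps b t) =
  (\sum_(p : 'I_n * 'I_L) \sum_(q : 'I_n * 'I_L)
    b (mxtens_index p) 0 *
    (if s - p.2%:Z == t - q.2%:Z then Sigma p.1 q.1 else 0) *
    b (mxtens_index q) 0)%:E.
Proof.
have [e2 _ ecov] := heps.
have fE u : filter_output eps b u = fun x => \sum_(p : 'I_n * 'I_L)
    b (mxtens_index p) 0 * eps (u - p.2%:Z) p.1 x.
  by apply/funext => x; rewrite /filter_output pair_bigA; apply: eq_bigr => -[].
rewrite !fE.
exact: (@covariance_lincomb _ _ _ _ _ (fun p => b (mxtens_index p) 0)
  (fun p => eps (s - p.2%:Z) p.1 : T -> R) (fun p => eps (t - p.2%:Z) p.1 : T -> R)).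
Qed.

Lemma filter_variance (b : 'cV[R]_(n * L)) (t : int) :
  'V_P[filter_output eps b t] = (bform (Itilde L Sigma) b b)%:E.
Proof.
rewrite /variance filter_covariance bform_tens; congr EFin.
apply: eq_bigr => p _; apply: eq_bigr => q _.
rewrite mxE (inj_eq (addrI _)) eqr_opp eqz_nat.
by case: ifP => /eqP pq; rewrite ?(val_inj pq) ?eqxx ?mulr1//;
  case: eqP pq => [->|]; rewrite ?mulr0.
Qed.

(** Across one time step, white noise pairs only lags [p.2 = q.2 + 1], which gives a one-sided shift
    instead of M. *)
Lemma filter_autocovariance (b : 'cV[R]_(n * L)) (t : int) :
  covariance P (filter_output eps b t) (filter_output eps b (t - 1)) =
  (bform (Mtilde L Sigma) b b)%:E.
Proof.
rewrite filter_covariance bform_tens; congr EFin.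
pose X (p q : 'I_n * 'I_L) := b (mxtens_index p) 0 *
  (if (p.2 == q.2.+1 :> nat) then Sigma p.1 q.1 else 0) * b (mxtens_index q) 0.
transitivity (\sum_p \sum_q (X p q)).
  apply: eq_bigr => p _; apply: eq_bigr => q _.
  rewrite -addrA (inj_eq (addrI _)) -opprD eqr_opp.
  by rewrite /X -[1 + _]/((q.2.+1)%:Z) eqz_nat.
(* Averaging with the transposed sum, allowed as [Sigma] is symmetric, splits the shift into the two
   off-diagonals of M with entries 1/2. *)
transitivity (\sum_p \sum_q (2^-1 * X p q + 2^-1 * X q p)); last first.
  apply: eq_bigr => p _; apply: eq_bigr => q _; rewrite /X mxE.
  have -> : Sigma q.1 p.1 = Sigma p.1 q.1 by rewrite -[in LHS]hsym mxE.
  rewrite [p.2 == _ :> nat]eq_sym [q.2 == _ :> nat]eq_sym.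
  have [pq|_] := eqVneq p.2.+1 (q.2 : nat).
    by rewrite -pq gtn_eqF ?ltnS ?leqnSn//=; ring.
  by case: ifP => _ /=; ring.
under [RHS]eq_bigr do rewrite big_split.
rewrite big_split/= [X in _ = _ + X]exchange_big/= -big_split/=.
apply: eq_bigr => p _; rewrite -big_split/=; apply: eq_bigr => q _.
by field.
Qed.

Lemma filter_autocorrelation1 (b : 'cV[R]_(n * L)) (t : int) :
  0 <= bform (Itilde L Sigma) b b ->
  autocorrelation1 P (filter_output eps b) t = acf Sigma b.
Proof.
move=> b0; rewrite /autocorrelation1 filter_autocovariance !filter_variance/=.
by rewrite -expr2 sqr_sqrtr.
Qed.

End filters.

(** * The M-SSA filter *)

Section mssa_moments.
Context (R : realType) (n L : nat) (Sigma : 'M[R]_n).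
Context (sigma : 'I_n -> R) (vsigma : 'I_n -> 'cV[R]_n).
Hypothesis heig : forall j, Sigma *m vsigma j = sigma j *: vsigma j.
Hypothesis horth : orthonormal_family vsigma.
Hypothesis sigma_gt0 : forall j, 0 < sigma j.
Hypothesis hsym : Sigma^T = Sigma.
Context (w : 'I_L -> 'I_n -> R).
Hypothesis hcomplete : complete_spectral_support w.
Hypothesis hL : (0 < L)%N.
Hypothesis rho_max_gt0 : 0 < rho_max L :> R.
Context (l : R).
Hypothesis l_gt0 : 0 < l.

(** The share of [lambda k] in the squared length of gamma in the [Itilde] norm. *)
Definition energy (k : 'I_L) : R := \sum_j sigma j * w k j ^+ 2.

Local Notation It := (Itilde L Sigma).
Local Notation Mt := (Mtilde L Sigma).
Local Notation N := (Nmx L Sigma).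
Local Notation mom := (moment energy (@lambda R L)).
Local Notation gamma := (synth vsigma w).
Local Notation u := (mssa_direction Sigma gamma).
Local Notation D := (mssa_scale Sigma gamma l).
Local Notation b := (mssa_filter Sigma gamma l).

Let kmax : 'I_L := Ordinal hL.
Let kmin : 'I_L := rev_ord kmax.

Let sigma_neq0 j : sigma j != 0. Proof. by rewrite gt_eqF. Qed.

Lemma energy_gt0 k : 0 < energy k.
Proof.
have ge0 j : 0 <= sigma j * w k j ^+ 2 by rewrite mulr_ge0 ?sqr_ge0// ltW.
have [j wj] : exists j, w k j != 0.
  apply/existsP; apply: contraR (hcomplete k) => /existsPn w0.
  by rewrite big1// => j _; apply/eqP; rewrite normr_eq0; apply/negPn/w0.
apply: (psumr_gt0_witness (i0 := j)) => //.
by rewrite mulr_gt0// exprn_even_gt0.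
Qed.

Let lambda_max : lambda kmax = rho_max L :> R. Proof. exact: lambda_first. Qed.

Let lambda_min : lambda kmin = - rho_max L :> R.
Proof. by rewrite lambda_rev lambda_max. Qed.

Lemma admissible_pole (nu : R) : admissible L nu -> forall k : 'I_L, 2 * lambda k - nu != 0.
Proof. by move=> adm k; rewrite subr_eq0 eq_sym. Qed.

Lemma admissible_outer (nu : R) : 2 * rho_max L < `|nu| -> admissible L nu.
Proof.
move=> h k; rewrite eq_sym -subr_eq0.
exact: (pole_neq0 (@lambda_norm_le R L)).
Qed.

(** The moment of order 0 is constant in [nu]; keeping [nu] lets it be combined with the other
    moments at the same point. *)
Lemma bform_gamma (nu : R) : bform It gamma gamma = mom 0 nu.
Proof.
rewrite (bform_It_synth heig)// moment0E; apply: eq_bigr => k _.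
by apply: eq_bigr => j _; rewrite expr2.
Qed.

Lemma bform_Mt_gamma : bform Mt gamma gamma = \sum_k lambda k * energy k.
Proof.
by rewrite (bform_Mt_synth heig)//; apply: eq_bigr => k _; congr (_ * _).
Qed.

Section admissible.
Context (nu : R).
Hypothesis adm : admissible L nu.

Let uE := mssa_direction_synth heig horth sigma_neq0 w adm.

Lemma bform_gamma_direction : bform It gamma (u nu) = mom 1 nu.
Proof.
rewrite uE (bform_It_synth heig)//; apply: eq_bigr => k _.
by rewrite mulr_suml; apply: eq_bigr => j _; ring.
Qed.

Lemma bform_direction : bform It (u nu) (u nu) = mom 2 nu.
Proof.
rewrite uE (bform_It_synth heig)//; apply: eq_bigr => k _.
by rewrite mulr_suml; apply: eq_bigr => j _; ring.
Qed.

Lemma bform_Mt_direction : bform Mt (u nu) (u nu) =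
  \sum_k lambda k * (energy k * pole (lambda k) nu ^+ 2).
Proof.
rewrite uE (bform_Mt_synth heig)//; apply: eq_bigr => k _; congr (_ * _).
by rewrite mulr_suml; apply: eq_bigr => j _; ring.
Qed.

Let mom2_gt0 : 0 < mom 2 nu.
Proof. exact: (moment2_gt0 kmax energy_gt0 (admissible_pole adm)). Qed.

Lemma mssa_scale_sqr : D nu ^+ 2 = l / mom 2 nu.
Proof.
have lm : 0 <= l / mom 2 nu by rewrite divr_ge0 ?ltW.
rewrite /mssa_scale bform_direction exprMn sqr_sqrtr//.
by case: leP => _; rewrite ?sqrrN expr1n mul1r.
Qed.

Lemma mssa_scale_neq0 : D nu != 0.
Proof. by rewrite -sqrf_eq0 mssa_scale_sqr mulf_neq0 ?invr_eq0// gt_eqF. Qed.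

Lemma bform_filter : bform It (b nu) (b nu) = l.
Proof.
rewrite bformZl bformZr mulrA -expr2 mssa_scale_sqr bform_direction.
by rewrite divfK// gt_eqF.
Qed.

Lemma acf_filter : acf Sigma (b nu) =
  (\sum_k lambda k * (energy k * pole (lambda k) nu ^+ 2)) / mom 2 nu.
Proof.
rewrite /acf !bformZl !bformZr bform_Mt_direction bform_direction.
by field; rewrite mssa_scale_neq0 lt0r_neq0.
Qed.

(** The length constraint fixes the modulus of [c]. The objective is [c * mom 1 nu], so its
    positivity makes [mom 1 nu] nonzero and fixes the sign. *)
Lemma mssa_scale_unique c : bform It (c *: u nu) (c *: u nu) = l ->
  0 < bform It gamma (c *: u nu) -> c = D nu.
Proof.
rewrite bformZl !bformZr bform_gamma_direction bform_direction => cl cpos.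
have -> : D nu = (if 0 <= mom 1 nu then 1 else -1) * `|c|.
  rewrite /mssa_scale bform_gamma_direction bform_direction -sqrtr_sqr.
  by congr (_ * Num.sqrt _); rewrite -cl; field; rewrite gt_eqF.
have [m1|m1] := leP 0 (mom 1 nu).
  have {}m1 : 0 < mom 1 nu.
    by rewrite lt_neqAle m1 andbT; apply: contraTneq cpos => <-; rewrite mulr0 ltxx.
  by rewrite mul1r gtr0_norm// -(pmulr_lgt0 _ m1).
by rewrite mulN1r ltr0_norm ?opprK// -(nmulr_lgt0 _ m1).
Qed.

Lemma trmx_Nmx : (N nu)^T = N nu.
Proof.
by rewrite /Nmx linearB/= !linearZ/= !trmx_tens hsym trmx_Mmx trmx1.
Qed.

Lemma corr_gain_direction : corr_gain Sigma gamma nu =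
  Num.sqrt (mom 2 nu) / Num.sqrt (mom 0 nu).
Proof.
rewrite /corr_gain -bform_gamma -bform_direction.
by congr (Num.sqrt _ / _); rewrite /bform /mssa_direction !trmx_mul !mulmxA.
Qed.

(** Correlation is invariant under positive scaling, so [l] cancels and only the sign of the scale
    survives. *)
Lemma target_corr_filter : target_corr Sigma gamma (b nu) =
  (if 0 <= mom 1 nu then 1 else -1) * mom 1 nu /
  (Num.sqrt (mom 2 nu) * Num.sqrt (mom 0 nu)).
Proof.
have m0 : 0 < mom 0 nu := moment0_gt0 _ kmax energy_gt0 nu.
rewrite /target_corr bform_filter -bform_gamma.
have -> : bform It (b nu) gamma = D nu * mom 1 nu.
  rewrite -bform_gamma_direction bformZl; congr (_ * _).
  rewrite uE !(bform_It_synth heig)//; apply: eq_bigr => k _.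
  by apply: eq_bigr => j _; rewrite [_ * w _ _]mulrC.
rewrite /mssa_scale bform_gamma_direction bform_direction (bform_gamma nu).
rewrite !sqrtrM ?(ltW l_gt0)// sqrtrV ?(ltW mom2_gt0)//.
set c := (if _ then _ else _); set m1 := mom 1 nu.
by field; rewrite !sqrtr_eq0 -!ltNge l_gt0 m0 mom2_gt0.
Qed.

End admissible.

Lemma acf_gamma : acf Sigma gamma = (\sum_k lambda k * energy k) / \sum_k energy k.
Proof. by rewrite /acf bform_Mt_gamma (bform_gamma 0) moment0E. Qed.

(** * Optimality and uniqueness of the filter for nu beyond the spectrum *)

Section outer.
Context (nu : R).
Hypothesis nu_outer : 2 * rho_max L < `|nu|.

Let adm := admissible_outer nu_outer.
Let lambda_bnd := @lambda_norm_le R L.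

Lemma mssa_scale_sg : (if 0 <= mom 1 nu then 1 else -1) = - Num.sg nu :> R.
Proof.
have := moment1_sg kmax energy_gt0 lambda_bnd nu_outer.
have : nu != 0.
  by apply: contraTneq nu_outer => ->; rewrite normr0 -leNgt mulr_ge0// ltW.
case: (ltrgtP nu 0) => // n0 _.
  by rewrite ltr0_sg// opprK mul1r => /ltW ->.
by rewrite gtr0_sg// mulN1r oppr_gt0 => /lt_geF ->.
Qed.

Lemma mssa_scale_sg_gt0 : 0 < - Num.sg nu * D nu.
Proof.
have m1 := moment1_sg kmax energy_gt0 lambda_bnd nu_outer.
have s2 : Num.sg nu ^+ 2 = 1.
  by rewrite sqr_sg; case: eqP m1 => // ->; rewrite sgr0 oppr0 mul0r ltxx.
rewrite /mssa_scale bform_gamma_direction// mssa_scale_sg mulrA mulrNN -expr2 s2 mul1r.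
rewrite sqrtr_gt0 divr_gt0// bform_direction//.
exact: (moment2_gt0 kmax energy_gt0 (admissible_pole adm)).
Qed.

Lemma objective_filter_gt0 : 0 < bform It gamma (b nu).
Proof.
have m1 := moment1_sg kmax energy_gt0 lambda_bnd nu_outer.
have s2 : Num.sg nu ^+ 2 = 1.
  by rewrite sqr_sg; case: eqP m1 => // ->; rewrite sgr0 oppr0 mul0r ltxx.
rewrite bformZr bform_gamma_direction//.
by have := mulr_gt0 mssa_scale_sg_gt0 m1; rewrite mulrACA mulrNN -expr2 s2 mul1r.
Qed.

(** All eigenvalues [sigma j * (2 * lambda k - nu)] of N share the sign of [- nu], so N is
    definite. *)
Lemma bform_N_sg_gt0 y : y != 0 -> 0 < - Num.sg nu * bform (N nu) y y.
Proof.
have res := vtilde_resolution L horth.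
rewrite (bform_spectral res _ _ (Nmx_eigen heig nu)) mulr_sumr => y0.
have sgE (p : 'I_L * 'I_n) : 0 < - Num.sg nu * (sigma p.2 * (2 * lambda p.1 - nu)).
  have d0 := admissible_pole adm p.1.
  (* A denominator is its pole times a square, so [pole_sg] supplies the sign. *)
  have -> : - Num.sg nu * (sigma p.2 * (2 * lambda p.1 - nu)) =
      sigma p.2 * (- Num.sg nu * pole (lambda p.1) nu * (2 * lambda p.1 - nu) ^+ 2).
    by rewrite /pole; field.
  by rewrite mulr_gt0// mulr_gt0 ?exprn_even_gt0// (pole_sg lambda_bnd).
have [p cp] : exists p, bform 1%:M (vtilde vsigma p.1 p.2) y != 0.
  apply/existsP; apply: contraNT y0 => /existsPn c0.
  rewrite (spectral_expansion res y) big1// => p _.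
  by move: (c0 p); rewrite negbK => /eqP ->; rewrite scale0r.
apply: (psumr_gt0_witness (i0 := p)) => [q|]; rewrite mulrA -expr2.
  by rewrite mulr_ge0 ?sqr_ge0// ltW.
by rewrite mulr_gt0// exprn_even_gt0.
Qed.

Lemma bform_Nmx x y : bform (N nu) x y = 2 * bform Mt x y - nu * bform It x y.
Proof. by rewrite /bform mulmxBr mulmxBl -!scalemxAr -!scalemxAl !mxE. Qed.

(** This is the stationarity condition of the Lagrangian: N applied to the filter is [D nu] times
    [It *m gamma]. *)
Lemma bform_Nmx_filter y : bform (N nu) (b nu) y = D nu * bform It gamma y.
Proof.
have Isym : It^T = It by rewrite trmx_tens hsym trmx1.
rewrite bformZl; congr (_ * _); rewrite /bform -{1}(trmx_Nmx nu) -trmx_mul.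
rewrite mulmxA mulmxA mulmxV ?mul1mx ?trmx_mul ?Isym//.
exact: (Nmx_unitmx heig horth sigma_neq0 adm).
Qed.

Context (rho_i : R).
Hypothesis nu_rho : acf Sigma (b nu) = rho_i.

Lemma filter_feasible : mssa_feasible Sigma rho_i l (b nu).
Proof.
split; last exact: bform_filter.
by rewrite -nu_rho /acf bform_filter// mulrC divfK// gt_eqF.
Qed.

(* b(nu) and y give N the same value, and bform N (b nu) is a multiple of the
   objective, so the square only retains the objective gap. *)
Lemma objective_gap y : mssa_feasible Sigma rho_i l y ->
  bform (N nu) (y - b nu) (y - b nu) =
  2 * D nu * (bform It gamma (b nu) - bform It gamma y).
Proof.
move=> [y1 y2]; have [b1 b2] := filter_feasible.
rewrite bform_sub_sym ?trmx_Nmx// bform_Nmx_filter.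
have -> : bform (N nu) y y = bform (N nu) (b nu) (b nu).
  by rewrite !bform_Nmx y1 y2 b1 b2.
by rewrite bform_Nmx_filter; ring.
Qed.

(** In [objective_gap] both the form N and the scale [D nu] become positive after multiplication by
    [- Num.sg nu], so the gap is positive. *)
Lemma objective_gap_gt0 y : mssa_feasible Sigma rho_i l y -> y != b nu ->
  bform It gamma y < bform It gamma (b nu).
Proof.
move=> fy yb; rewrite -subr_gt0 -(pmulr_rgt0 _ mssa_scale_sg_gt0).
rewrite -(pmulr_rgt0 _ (ltr0n R 2)).
have := @bform_N_sg_gt0 (y - b nu); rewrite subr_eq0 => /(_ yb).
by rewrite objective_gap// => /lt_le_trans; apply; rewrite le_eqVlt; apply/orP;
  left; apply/eqP; ring.
Qed.

Lemma filter_solution : mssa_solution Sigma gamma rho_i l (b nu).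
Proof.
split; first exact: filter_feasible.
by move=> y fy; have [->//|yb] := eqVneq y (b nu); rewrite ltW// objective_gap_gt0.
Qed.

Lemma solution_unique y : mssa_solution Sigma gamma rho_i l y -> y = b nu.
Proof.
move=> [fy maxy]; apply/eqP/negPn/negP => yb.
by have := maxy _ filter_feasible; rewrite leNgt objective_gap_gt0.
Qed.

End outer.

Lemma exists_outer_pole r : `|r| < rho_max L -> r != acf Sigma gamma ->
  exists2 nu, 2 * rho_max L < `|nu| & acf Sigma (b nu) = r.
Proof.
move=> rb rne.
have e0 : 0 < \sum_k energy k.
  by rewrite -(moment0E _ (@lambda R L) 0) (moment0_gt0 _ kmax energy_gt0).
have [|nu h1 h2] := @weighted_mean_root R L energy _ _ r kmax kmin energy_gt0
  (@lambda_norm_le R L) rho_max_gt0 (@lambda_inj R L) lambda_max lambda_min rb.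
  by apply: contraNneq rne => h; rewrite acf_gamma h mulfK// gt_eqF.
exists nu => //; have adm := admissible_outer h1.
rewrite acf_filter// h2 mulfK// gt_eqF//.
exact: (moment2_gt0 kmax energy_gt0 (admissible_pole adm)).
Qed.

(** Places rho above the MSE value for positive [nu] and below it for negative [nu], directly from
    Chebyshev and without monotonicity. *)
Lemma acf_filter_sg nu : 2 * rho_max L < `|nu| ->
  0 < Num.sg nu * (acf Sigma (b nu) - acf Sigma gamma).
Proof.
move=> h; have adm := admissible_outer h.
have m2 := moment2_gt0 kmax energy_gt0 (admissible_pole adm).
have m0 := moment0_gt0 (@lambda R L) kmax energy_gt0 nu.
have := weighted_mean_sg energy_gt0 (@lambda_norm_le R L) rho_max_gt0
  lambda_max lambda_min h.
rewrite acf_filter// acf_gamma -(moment0E energy (@lambda R L) nu).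
set X := \sum_k lambda k * (_ * _); set Y := \sum_k lambda k * energy k => XY.
have -> : Num.sg nu * (X / mom 2 nu - Y / mom 0 nu) =
    Num.sg nu * (X * mom 0 nu - Y * mom 2 nu) / (mom 2 nu * mom 0 nu).
  by field; rewrite !gt_eqF.
by rewrite divr_gt0// mulr_gt0.
Qed.

Lemma cvg_acf_filter (F : set_system R) {FF : ProperFilter F} :
  x^-1 @[x --> F] --> (0 : R) -> (\forall x \near F, 2 * rho_max L < `|x|) ->
  acf Sigma (b x) @[x --> F] --> acf Sigma gamma.
Proof.
move=> cV out; rewrite acf_gamma.
have xn0 : \forall x \near F, x != 0.
  near=> x; have : 2 * rho_max L < `|x| by near: x.
  by apply: contraTneq => ->; rewrite normr0 -leNgt mulr_ge0// ltW.
apply: cvg_trans (cvg_weighted_mean energy_gt0 hL cV xn0 (a := @lambda R L)).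
apply: near_eq_cvg; near=> x.
by rewrite acf_filter//; apply: admissible_outer; near: x.
Unshelve. all: by end_near.
Qed.

(** The outer set is open, so closed forms valid only there can be differentiated at [nu]. *)
Lemma near_outer (nu : R) : 2 * rho_max L < `|nu| ->
  \forall x \near nu, 2 * rho_max L < `|x|.
Proof. exact: (@cvgr_gt _ _ (nbhs nu) _ (fun x : R => `|x|) `|nu| (cvg_norm cvg_id)). Qed.

Lemma near_sg (nu : R) : nu != 0 -> \forall x \near nu, Num.sg x = Num.sg nu.
Proof.
move=> nu0; have cv : x @[x --> nu] --> nu by exact: cvg_id.
have [n0|n0] := ltP nu 0.
  by near=> x; rewrite !ltr0_sg//; near: x; exact: (cvgr_lt nu cv).
have {}n0 : 0 < nu by rewrite lt_neqAle eq_sym nu0.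
by near=> x; rewrite !gtr0_sg//; near: x; exact: (cvgr_gt nu cv).
Unshelve. all: by end_near.
Qed.

(** * Derivatives of the autocorrelation and of the target correlation *)

Section derivatives.
Context (nu : R).
Hypothesis nu_outer : 2 * rho_max L < `|nu|.

Let adm := admissible_outer nu_outer.
Let np := admissible_pole adm.
Let m2 := moment2_gt0 kmax energy_gt0 np.
Let m0 := moment0_gt0 (@lambda R L) kmax energy_gt0 nu.
Local Notation gap := (mom 2 nu ^+ 2 - mom 1 nu * mom 3 nu).

(** Near [nu], rho is half of [mom 1 / mom 2 + x]. By the quotient rule and [is_derive_moment], its
    derivative involves only moments 1 to 3. *)
Lemma is_derive_acf_filter :
  is_derive nu (1 : R) (fun x => acf Sigma (b x)) (gap / mom 2 nu ^+ 2).
Proof.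
have d1 := is_derive_moment energy 1 np.
have d2 := is_derive_moment energy 2 np.
have dV := is_deriveV (lt0r_neq0 m2) d2.
have dM := is_deriveM d1 dV.
have dA := is_deriveZ (2^-1 : R) (is_deriveD dM (is_derive_id nu (1 : R))).
apply: near_eq_is_derive (is_derive_eq dA _); last first.
  have eqn (B C E : R) : B != 0 ->
      2^-1 * (C * (- B ^- 2 * (2 * E)) + B^-1 * (1 * B) + 1) = (B ^+ 2 - C * E) / B ^+ 2.
    by move=> B0; field.
  exact/eqn/lt0r_neq0.
near=> x.
have xo : 2 * rho_max L < `|x| by near: x; exact: near_outer.
have xadm := admissible_outer xo.
rewrite acf_filter// weighted_moment; last exact: admissible_pole.
have eqn (B C : R) : B != 0 -> 2^-1 * (C * B^-1 + x) = (C + x * B) / 2 / B.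
  by move=> B0; field.
exact/eqn/lt0r_neq0/(moment2_gt0 kmax energy_gt0)/admissible_pole.
Unshelve. all: by end_near.
Qed.

(** Near [nu] the sign and [mom 0] are constant, so only [mom 1 / sqrt (mom 2)] is differentiated.
    The same [gap] appears as in the derivative of rho, which yields the relation in (d). *)
Lemma is_derive_target_corr_filter :
  is_derive nu (1 : R) (fun x => target_corr Sigma gamma (b x))
    (- Num.sg nu * (Num.sqrt (mom 2 nu) / Num.sqrt (mom 0 nu) *
                    (gap / mom 2 nu ^+ 2))).
Proof.
have nu0 : nu != 0.
  by apply: contraTneq nu_outer => ->; rewrite normr0 -leNgt mulr_ge0// ltW.
have d1 := is_derive_moment energy 1 np.
have dS := is_derive1_comp (is_derive1_sqrt m2) (is_derive_moment energy 2 np).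
have sq0 : Num.sqrt (mom 2 nu) != 0 by rewrite gt_eqF// sqrtr_gt0.
have dV := is_deriveV (f := Num.sqrt \o mom 2) sq0 dS.
have dM := is_deriveM d1 dV.
have dA := is_deriveZ (- Num.sg nu / Num.sqrt (mom 0 nu)) dM.
apply: near_eq_is_derive (is_derive_eq dA _); last first.
  have eqn (e q S B C E : R) : q != 0 -> S != 0 -> q ^+ 2 = B ->
      e / S * (C * (- q ^- 2 * ((2 * q)^-1 * (2 * E))) + q^-1 * (1 * B)) =
      e * (q / S * ((B ^+ 2 - C * E) / B ^+ 2)).
    by move=> q0 S0 <-; field; rewrite q0 S0.
  apply: eqn => //; last exact/sqr_sqrtr/ltW.
  by rewrite gt_eqF// sqrtr_gt0.
near=> x.
have xo : 2 * rho_max L < `|x| by near: x; exact: near_outer.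
rewrite target_corr_filter ?mssa_scale_sg//; last exact: admissible_outer.
have -> : Num.sg x = Num.sg nu by near: x; exact: near_sg.
rewrite (moment0E _ _ x) -(moment0E energy (@lambda R L) nu).
have eqn (e S q C : R) : e / S * (C * q^-1) = e * C / (q * S).
  by rewrite invfM; ring.
exact: eqn.
Unshelve. all: by end_near.
Qed.

Lemma gap_lt0 : gap < 0.
Proof.
rewrite subr_lt0.
exact: (moment_gap energy_gt0 (@lambda_norm_le R L) rho_max_gt0 lambda_max lambda_min).
Qed.

End derivatives.

End mssa_moments.

Theorem theorem1 (R : realType) (d : measure_display) (T : measurableType d)
  (P : probability T R) (L n : nat) (hL : (1 <= L)%N) (hn : (1 <= n)%N)
  (hLn : (2 < L * n)%N)
  (Sigma : 'M[R]_n) (hSigma : covariance_matrix Sigma) (hfull : \rank Sigma = n)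
  (eps : int -> 'I_n -> {RV P >-> R}) (heps : white_noise Sigma eps)
  (Gamma : int -> 'M[R]_n) (hGamma : square_summable Gamma) (delta : int)
  (hgamma : mse_weights L Gamma delta != 0)
  (sigma : 'I_n -> R) (vsigma : 'I_n -> 'cV[R]_n)
  (heig : forall j, Sigma *m vsigma j = sigma j *: vsigma j)
  (horth : orthonormal_family vsigma)
  (i : 'I_n) (gamma : 'cV[R]_(n * L))
  (hgammai : gamma = col i (mse_weights L Gamma delta))
  (w : 'I_L -> 'I_n -> R)
  (hw : gamma = \sum_(k < L) \sum_(j < n) w k j *: vtilde vsigma k j)
  (l : R) (hl : 0 < l) (rho_i : R)
  (hnondeg : rho_i != acf Sigma gamma)
  (hinterior : `|rho_i| < rho_max L)
  (hcomplete : complete_spectral_support w) :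
  let It := Itilde L Sigma in
  let N := Nmx L Sigma in
  let D := mssa_scale Sigma gamma l in
  let b := mssa_filter Sigma gamma l in
  let rho := fun nu : R => acf Sigma (b nu) in
  let rho_mse := acf Sigma gamma in
  let tcorr := fun nu : R => target_corr Sigma gamma (b nu) in
  (* (a) *)
  ((exists b0, mssa_solution Sigma gamma rho_i l b0) /\
   (forall b0, mssa_solution Sigma gamma rho_i l b0 ->
      exists nu : R,
        admissible L nu /\
        (N nu)^T = N nu /\ N nu \in unitmx /\
        D nu != 0 /\
        b0 = D nu *: (invmx (N nu) *m It *m gamma) /\
        b0 = D nu *: (\sum_(k < L) (2 * lambda k - nu)^-1 *:
                        (\sum_(j < n) w k j *: vtilde vsigma k j)) /\
        0 < bform It gamma b0 /\
        (forall D' : R, let b' := D' *: (invmx (N nu) *m It *m gamma) in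
           bform It b' b' = l -> 0 < bform It gamma b' -> D' = D nu))) /\
  (* (b) *)
  ((forall nu : R, admissible L nu ->
      D nu != 0 /\
      (forall t : int,
         autocorrelation1 P (filter_output eps (b nu)) t = rho nu) /\
      rho nu =
        (\sum_(k < L) lambda k * ((2 * lambda k - nu) ^+ 2)^-1 *
           (\sum_(j < n) sigma j * w k j ^+ 2)) /
        (\sum_(k < L) ((2 * lambda k - nu) ^+ 2)^-1 *
           (\sum_(j < n) sigma j * w k j ^+ 2))) /\
   (forall r : R, `|r| < rho_max L -> r != rho_mse ->
      exists nu : R, admissible L nu /\ rho nu = r)) /\
  (* (c) *)
  ((forall nu : R, 2 * rho_max L < `|nu| ->
      derivable rho nu 1 /\ derive1 rho nu < 0) /\
   (let A := [set rho nu | nu in [set nu : R | nu < - (2 * rho_max L)]] in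
    has_sup A /\ sup A = rho_mse) /\
   (let A := [set rho nu | nu in [set nu : R | 2 * rho_max L < nu]] in
    has_inf A /\ inf A = rho_mse) /\
   (rho x @[x --> +oo] --> rho_mse) /\
   (rho x @[x --> -oo] --> rho_mse) /\
   (forall t : int,
      autocorrelation1 P (filter_output eps gamma) t = rho_mse) /\
   (forall nu1 nu2 : R, 2 * rho_max L < nu1 -> nu2 < - (2 * rho_max L) ->
      rho nu2 < rho nu1)) /\
  (* (d) *)
  (forall nu : R, 2 * rho_max L < `|nu| ->
     derivable tcorr nu 1 /\
     - Num.sg nu * derive1 tcorr nu = corr_gain Sigma gamma nu * derive1 rho nu /\
     corr_gain Sigma gamma nu * derive1 rho nu < 0 /\
     (Sigma = 1%:M ->
        - Num.sg nu * derive1 tcorr nu =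
          euclidean_corr_gain Sigma gamma nu * derive1 rho nu)).
Proof.
move=> It N D b rho rho_mse tcorr.
have [hsym _] := hSigma.
have sigma_gt0 := covariance_eigenvalue_gt0 hSigma hfull heig horth.
(* An interior [rho_i] can exist only if [rho_max L] is positive, which rules out L = 1. *)
have rm0 : 0 < rho_max L :> R by exact: le_lt_trans (normr_ge0 _) hinterior.
have {hw}gammaE : gamma = synth vsigma w := hw.
rewrite gammaE in hnondeg It N D b rho rho_mse tcorr *.
have outer_adm (nu : R) : 2 * rho_max L < `|nu| -> admissible L nu.
  exact: admissible_outer.
have rho_sg := acf_filter_sg heig horth sigma_gt0 hcomplete hL rm0 hl.
have itv_lt (nu : R) : nu < - (2 * rho_max L) -> 2 * rho_max L < `|nu| /\ nu < 0.
  move=> h; have nu0 : nu < 0 by rewrite (lt_trans h)// oppr_lt0 mulr_gt0.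
  by rewrite ltr0_norm// ltrNr.
have itv_gt (nu : R) : 2 * rho_max L < nu -> 2 * rho_max L < `|nu| /\ 0 < nu.
  move=> h; have nu0 : 0 < nu by rewrite (lt_trans _ h)// mulr_gt0.
  by rewrite gtr0_norm.
have rho_lt (nu : R) : nu < - (2 * rho_max L) -> rho nu < rho_mse.
  move=> /itv_lt[h nu0]; have := rho_sg nu h.
  by rewrite ltr0_sg// mulN1r oppr_gt0 subr_lt0.
have rho_gt (nu : R) : 2 * rho_max L < nu -> rho_mse < rho nu.
  move=> /itv_gt[h nu0]; have := rho_sg nu h.
  by rewrite gtr0_sg// mul1r subr_gt0.
have outer_p : \forall x \near +oo, 2 * rho_max L < `|x : R|.
  near=> x; apply: (proj1 (itv_gt _ _)); near: x; exact/nbhs_pinfty_gt/num_real.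
have outer_n : \forall x \near -oo, 2 * rho_max L < `|x : R|.
  near=> x; apply: (proj1 (itv_lt _ _)); near: x; exact/nbhs_ninfty_lt/num_real.
have cvg_p : rho x @[x --> +oo] --> rho_mse.
  by apply: cvg_acf_filter => //; exact: cvg_inv_pinfty.
have cvg_n : rho x @[x --> -oo] --> rho_mse.
  by apply: cvg_acf_filter => //; exact: cvg_inv_ninfty.
have dr := is_derive_acf_filter heig horth sigma_gt0 hcomplete hL hl.
have dt := is_derive_target_corr_filter heig horth sigma_gt0 hcomplete hL rm0 hl.
have gap0 := gap_lt0 sigma_gt0 hcomplete hL rm0.
have m2 (nu : R) (h : 2 * rho_max L < `|nu|) :=
  moment2_gt0 (Ordinal hL) (energy_gt0 sigma_gt0 hcomplete)
    (admissible_pole (outer_adm _ h)).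
have m0 := moment0_gt0 (@lambda R L) (Ordinal hL) (energy_gt0 sigma_gt0 hcomplete).
have drho_lt0 (nu : R) : 2 * rho_max L < `|nu| -> derive1 rho nu < 0.
  move=> h; rewrite derive1E (@derive_val _ _ _ _ _ _ _ (dr nu h)) pmulr_llt0 ?gap0//.
  by rewrite invr_gt0 exprn_gt0// m2.
split; [|split; [|split]].
(* Part (a): the outer [nu] attaining [rho_i] gives a solution, and uniqueness identifies every
   solution with it. *)
- have [nu nu1 nu2] := exists_outer_pole heig horth sigma_gt0 hcomplete hL rm0 hl
    hinterior hnondeg.
  have adm := outer_adm _ nu1.
  have sneq0 j : sigma j != 0 by rewrite gt_eqF.
  split; first by exists (b nu);
    exact: (filter_solution heig horth sigma_gt0 hsym hcomplete hL rm0 hl nu1 nu2).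
  move=> b0 sol; have bE : b0 = b nu.
    by apply: (solution_unique heig horth sigma_gt0 hsym hcomplete hL rm0 hl nu1 nu2 sol).
  exists nu; split => //; split; first exact: trmx_Nmx.
  split; first exact: (Nmx_unitmx heig horth).
  split; first exact: (mssa_scale_neq0 heig horth).
  split; first by [].
  split.
    rewrite bE /b /mssa_filter; congr (_ *: _).
    rewrite (mssa_direction_synth heig horth sneq0 w adm); apply: eq_bigr => k _.
    by rewrite scaler_sumr; apply: eq_bigr => j _; rewrite scalerA.
  split; first by rewrite bE; exact: (objective_filter_gt0 heig horth).
  by move=> c; exact: (mssa_scale_unique heig horth).
- split=> [nu adm|r rb rne]; last first.
    have [nu nu1 nu2] := exists_outer_pole heig horth sigma_gt0 hcomplete hL rm0 hl
      rb rne.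
    by exists nu; split => //; exact: outer_adm.
  split; first exact: (mssa_scale_neq0 heig horth).
  split.
    move=> t; apply: (filter_autocorrelation1 heps hsym).
    by rewrite (bform_filter heig horth) ?ltW.
  rewrite /rho (acf_filter heig horth)//.
  congr (_ / _); apply: eq_bigr => k _; last by rewrite /pole exprVn mulrC.
  by rewrite /pole exprVn -mulrA [energy _ _ _ * _]mulrC.
- split; [|split; [|split; [|split; [|split; [|split]]]]] => //.
  + by move=> nu h; split; [exact: (@ex_derive _ _ _ _ _ _ _ (dr nu h))|exact: drho_lt0].
  + move=> A.
    have A0 : A !=set0.
      exists (rho (- (2 * rho_max L) - 1)), (- (2 * rho_max L) - 1) => //=.
      by rewrite ltrBlDr ltrDl.
    have Aub : ubound A rho_mse by move=> _ [nu /= h <-]; exact/ltW/rho_lt.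
    split; first by split => //; exists rho_mse.
    (* On this side rho stays strictly below [rho_mse], so the supremum is reached only in the
       limit: its lower bound comes from the limit at -oo. *)
    apply/eqP; rewrite eq_le ge_sup//=; apply: (cvgr_to_le cvg_n).
    near=> x; apply: ub_le_sup; first by exists rho_mse.
    by exists x => //=; near: x; exact/nbhs_ninfty_lt/num_real.
  + move=> A.
    have A0 : A !=set0.
      exists (rho (2 * rho_max L + 1)), (2 * rho_max L + 1) => //=.
      by rewrite ltrDl.
    have Alb : lbound A rho_mse by move=> _ [nu /= h <-]; exact/ltW/rho_gt.
    split; first by split => //; exists rho_mse.
    apply/eqP; rewrite eq_le lb_le_inf// andbT; apply: (cvgr_to_ge cvg_p).
    near=> x; apply: ge_inf; first by exists rho_mse.
    by exists x => //=; near: x; exact/nbhs_pinfty_gt/num_real.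
  + move=> t; apply: (filter_autocorrelation1 heps hsym).
    by rewrite (bform_gamma heig horth w 0) ltW.
  + by move=> nu1 nu2 /rho_gt h1 /rho_lt h2; exact: lt_trans h1.
- move=> nu h; have adm := outer_adm _ h.
  have gE := corr_gain_direction heig horth sigma_gt0 w adm.
  have sg2 : Num.sg nu ^+ 2 = 1.
    rewrite sqr_sg; case: eqP h => // ->.
    by rewrite normr0 => /(lt_trans (mulr_gt0 (ltr0n R 2) rm0)); rewrite ltxx.
  (* The sign in the derivative of the target correlation squares to 1, and the remaining ratio of
     square roots is [corr_gain]. *)
  have tE : - Num.sg nu * derive1 tcorr nu =
      corr_gain Sigma (synth vsigma w) nu * derive1 rho nu.
    rewrite !derive1E (@derive_val _ _ _ _ _ _ _ (dr nu h)).
    rewrite (@derive_val _ _ _ _ _ _ _ (dt nu h)) gE.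
    by rewrite mulrA mulrNN -expr2 sg2 mul1r.
  split; first exact: (@ex_derive _ _ _ _ _ _ _ (dt nu h)).
  split; first exact: tE.
  split.
    rewrite pmulr_rlt0 ?drho_lt0// gE divr_gt0// sqrtr_gt0 ?m0//.
    exact: m2.
  move=> S1; rewrite tE; congr (_ * _).
  by rewrite /corr_gain /euclidean_corr_gain /Itilde S1 tensmx11 trmx1 !mulmx1 !mul1mx.
Unshelve. all: by end_near.
Qed.
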